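(* Let $k$ be a nonperfect field of characteristic $p$. Then for each power $p^s$ ($s\in\mathbb{N}$, $s\geq 1$) there exists a $k$-subgroup $H$ of $G=GL_{p^s}$ that is $G$-completely reducible over $k$ but not $G$-completely reducible.
   Context: Let $\overline{k}$ be an algebraic closure of $k$. A $k$-group is an affine algebraic group over $\overline{k}$ together with a choice of $k$-structure (equivalently, here, a smooth affine group scheme of finite type over $k$); $GL_{p^s}$ carries its standard $k$-structure. ''Subgroup of $G$'' means a (possibly non-$k$-defined) closed subgroup of $G$; a ''$k$-subgroup'' is a closed subgroup that is defined over $k$ (equivalently, a smooth closed $k$-subgroup scheme). Let $G$ be a connected reductive $k$-group. A subgroup $H$ of $G$ is called $G$-completely reducible over $k$ if whenever $H$ is contained in a $k$-defined parabolic subgroup $P$ of $G$, then $H$ is contained in a $k$-defined Levi subgroup of $P$. A subgroup $H$ is called $G$-completely reducible if it is $G$-completely reducible over $\overline{k}$, i.e. whenever $H$ is contained in a parabolic subgroup $P$ of $G$ (not necessarily $k$-defined), it is contained in some Levi subgroup of $P$. *)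

(* Defs.v *)
From HB Require Import structures.
From mathcomp Require Import all_boot all_order all_algebra.
From mathcomp Require Import mpoly.

Set Implicit Arguments.
Unset Strict Implicit.
Unset Printing Implicit Defensive.

Import GRing.Theory.
Local Open Scope ring_scope.

Definition perfect_field (k : fieldType) : Prop :=
  forall p : nat, p \in [pchar k] -> forall a : k, exists b : k, b ^+ p = a.

Definition is_algebraic_closure (k : fieldType) (K : closedFieldType)
    (iota : {rmorphism k -> K}) : Prop :=
  forall x : K, algebraicOver iota x.

Section AlgebraicGroups.
Variables (K : closedFieldType) (n : nat).
Implicit Types X Y G H P B L U : 'M[K]_n -> Prop.

Definition subset_of X Y : Prop := forall x, X x -> Y x.

(* GL_n is realised as the closed subvariety t * det(x) = 1 of affine
   (n^2 + 1)-space: the first n * n coordinates are the entries x_ij, the last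
   one is t = det(x)^-1. *)
Definition GL_coords (x : 'M[K]_n) : 'I_(n * n + 1) -> K :=
  row_mx (mxvec x) (\det x)^-1%:M ord0.

Definition regular_eval (f : {mpoly K[n * n + 1]}) (x : 'M[K]_n) : K :=
  f.@[GL_coords x].

Definition GL : 'M[K]_n -> Prop := fun x => x \in unitmx.

Definition Zariski_closed X : Prop :=
  exists S : {mpoly K[n * n + 1]} -> Prop,
    forall x, X x <-> GL x /\ forall f, S f -> regular_eval f x = 0.

Definition Zariski_connected X : Prop :=
  (exists x, X x) /\
  forall Y Z : 'M[K]_n -> Prop,
    Zariski_closed Y -> Zariski_closed Z ->
    (forall x, X x -> Y x \/ Z x) ->
    (forall x, X x -> ~ (Y x /\ Z x)) ->
    subset_of X Y \/ subset_of X Z.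

Definition vanishes_on X (f : {mpoly K[n * n + 1]}) : Prop :=
  forall x, X x -> regular_eval f x = 0.

(* The ideal of X is generated by its elements with coefficients in k. *)
Definition defined_over (k : fieldType) (iota : {rmorphism k -> K}) X : Prop :=
  forall f, vanishes_on X f ->
  exists r : seq ({mpoly K[n * n + 1]} * {mpoly k[n * n + 1]}),
    (forall q, q \in r -> vanishes_on X (map_mpoly iota q.2)) /\
    f = \sum_(q <- r) q.1 * map_mpoly iota q.2.

Definition is_subgroup H : Prop :=
  [/\ subset_of H GL, H 1%:M,
      forall x y, H x -> H y -> H (x *m y)
    & forall x, H x -> H (invmx x)].

Definition closed_subgroup G H : Prop :=
  [/\ is_subgroup H, Zariski_closed H & subset_of H G].

Definition k_subgroup (k : fieldType) (iota : {rmorphism k -> K}) G H : Prop :=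
  closed_subgroup G H /\ defined_over iota H.

Definition generated_subgroup X : 'M[K]_n -> Prop :=
  fun x => forall H, is_subgroup H -> subset_of X H -> H x.

Definition derived_subgroup H : 'M[K]_n -> Prop :=
  generated_subgroup (fun z => exists x y,
    [/\ H x, H y & z = invmx x *m invmx y *m x *m y]).

Definition solvable_subgroup H : Prop :=
  exists m, forall x, iter m derived_subgroup H x -> x = 1%:M.

Definition unipotent_subgroup H : Prop :=
  forall x, H x -> exists m, (x - 1%:M) ^+ m = 0.

Definition normalised_by P U : Prop :=
  forall g u, P g -> U u -> U (g *m u *m invmx g).

Definition connected_solvable G B : Prop :=
  [/\ closed_subgroup G B, Zariski_connected B & solvable_subgroup B].

Definition is_Borel G B : Prop :=
  connected_solvable G B /\
  forall B', connected_solvable G B' -> subset_of B B' -> subset_of B' B.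

(* For connected G, containing a Borel subgroup is the same as G / P being
   complete. *)
Definition is_parabolic G P : Prop :=
  closed_subgroup G P /\ exists B, is_Borel G B /\ subset_of B P.

Definition connected_normal_unipotent P U : Prop :=
  [/\ closed_subgroup P U, Zariski_connected U,
      normalised_by P U & unipotent_subgroup U].

Definition is_unipotent_radical P U : Prop :=
  connected_normal_unipotent P U /\
  forall V, connected_normal_unipotent P V -> subset_of V U.

(* P is the semidirect product of L and the normal subgroup U as an algebraic
   group: the last clause says that the projection l u |-> l is a morphism of
   varieties, so that multiplication L x U -> P is an isomorphism of
   varieties. *)
Definition semidirect_product P L U : Prop :=
  [/\ normalised_by P U,
      forall x, P x <-> exists l u, [/\ L l, U u & x = l *m u],
      forall x, L x -> U x -> x = 1%:M
    & exists f : 'I_n -> 'I_n -> {mpoly K[n * n + 1]},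
        forall l u, L l -> U u ->
        forall i j, regular_eval (f i j) (l *m u) = l i j].

Definition is_Levi P L : Prop :=
  closed_subgroup P L /\
  exists U, is_unipotent_radical P U /\ semidirect_product P L U.

Definition cr_over (k : fieldType) (iota : {rmorphism k -> K}) G H : Prop :=
  forall P, is_parabolic G P -> defined_over iota P -> subset_of H P ->
  exists L, [/\ is_Levi P L, defined_over iota L & subset_of H L].

(* Every closed subgroup is defined over K itself. *)
Definition cr G H : Prop := cr_over (idfun : {rmorphism K -> K}) G H.

End AlgebraicGroups.

Arguments GL K n x : clear implicits.

(* Main.v *)
Require Import Defs.
From HB Require Import structures.
From mathcomp Require Import all_boot all_order all_algebra.
From mathcomp Require Import mpoly ring.
From Stdlib Require Import Classical_Prop.

Set Implicit Arguments.
Unset Strict Implicit.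
Unset Printing Implicit Defensive.

Import GRing.Theory.
Local Open Scope ring_scope.

(** Let [n = p ^ s], let [a] be an element of [k] that is not a [p]-th power,
    and let [A] be the matrix of multiplication by [X] on [k[X] / (X^n - a)].
    This quotient is a field, purely inseparable of degree [n] over [k], and
    [H] is the centralizer of [A] in [GL_n]: the group of units of
    [kbar[A]], that is, the Weil restriction of the multiplicative group of
    that field.  It is cut out by linear equations over [k], so its
    [k]-points are dense and it is defined over [k]; it is connected and
    commutative.

    Over [kbar] there is [alpha] with [alpha ^ n = a], and [A - alpha] is
    nilpotent and nonzero.  By the Lie-Kolchin theorem [H] lies in a Borel
    subgroup, a conjugate of the lower triangular group.  The unipotent element
    [1 + (A - alpha)] of [H] lies in the unipotent radical of this Borel
    subgroup, and a Levi subgroup meets the unipotent radical trivially.  So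
    [H] is not completely reducible.

    Over [k], the only parabolic subgroup [P] that contains [H] and is defined
    over [k] is [GL_n], which is its own Levi subgroup because it has no
    nontrivial normal unipotent subgroup.  The argument avoids the
    correspondence between parabolic subgroups and flags.  The orthogonal of
    [P] for the trace form is the space of linear forms vanishing on [P], and
    since [P] is defined over [k] it is spanned by matrices with entries in [k]
    ([defined_over_linear_form]).  As [P] contains [A], these matrices form a
    space stable under [ad A], which is nilpotent because [A - alpha] is.  If
    the orthogonal were nonzero, it would therefore contain a nonzero matrix
    [y] over [k] that commutes with [A]; such a [y] is an element of the field
    [k[A]], hence invertible.  But [P] contains a Borel subgroup, and a matrix
    orthogonal to the lower triangular matrices is strictly lower triangular,
    hence singular ([trig_parabolic_spans]).  Therefore [P] spans the matrix
    algebra; a subgroup with this property that contains a Borel subgroup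
    contains all invertible rank-one perturbations of the identity, and these
    generate [GL_n] ([spanning_parabolic_full]). *)

(** * Regular functions, morphisms and connectedness in GL_n *)

Section Regular.
Variables (K : closedFieldType) (n : nat).
Implicit Types (h : 'M[K]_n -> K) (X Y Z : 'M[K]_n -> Prop).

Definition regular h : Prop :=
  exists f, forall x, GL K n x -> regular_eval f x = h x.

Definition entry_var (i j : 'I_n) : 'I_(n * n + 1) := lshift 1 (mxvec_index i j).
Definition detV_var : 'I_(n * n + 1) := rshift (n * n) ord0.

Lemma GL_coords_entry (x : 'M[K]_n) i j : GL_coords x (entry_var i j) = x i j.
Proof. by rewrite /GL_coords row_mxEl mxvecE. Qed.

Lemma GL_coords_detV (x : 'M[K]_n) : GL_coords x detV_var = (\det x)^-1.
Proof. by rewrite /GL_coords row_mxEr mxE eqxx mulr1n. Qed.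

Lemma coord_varP (i : 'I_(n * n + 1)) :
  (exists a b, i = entry_var a b) \/ i = detV_var.
Proof.
rewrite -(splitK i); case: (split i) => [j|j] /=; last by right; rewrite (ord1 j).
by left; case/mxvec_indexP: j => a b; exists a, b.
Qed.

(** Monomials are products of coordinates, and the coordinates on GL_n are the
   matrix entries and the inverse of the determinant. *)
Lemma regular_eval_ind (Q : ('M[K]_n -> K) -> Prop) :
    (forall h h', h =1 h' -> Q h -> Q h') ->
    (forall c, Q (fun=> c)) ->
    (forall h h', Q h -> Q h' -> Q (fun x => h x + h' x)) ->
    (forall h h', Q h -> Q h' -> Q (fun x => h x * h' x)) ->
    (forall i j, Q (fun x => x i j)) ->
    Q (fun x => (\det x)^-1) ->
  forall f, Q (regular_eval f).
Proof.
move=> Qext Qc Qadd Qmul Qent QdetV; elim/mpolyind => [|c m f _ _ IH].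
  by apply: Qext (Qc 0) => x; rewrite /regular_eval meval0.
apply: (Qext (fun x => c * ('X_[m]).@[GL_coords x] + regular_eval f x)).
  by move=> x; rewrite /regular_eval mevalD mevalZ.
apply: (Qadd _ _ _ IH); apply: (Qmul (fun=> c) _ (Qc c)).
apply: (Qext (fun x => \prod_i GL_coords x i ^+ m i)).
  by move=> x; rewrite mevalX.
elim: (index_enum _) => [|i s IHs].
  by apply: Qext (Qc 1) => x; rewrite big_nil.
apply: (Qext (fun x => GL_coords x i ^+ m i *
                \prod_(j <- s) GL_coords x j ^+ m j)).
  by move=> x; rewrite big_cons.
apply: (Qmul _ _ _ IHs); have Qi : Q (fun x => GL_coords x i).
  case: (coord_varP i) => [[a [b ->]]|->].
    by apply: Qext (Qent a b) => x; rewrite GL_coords_entry.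
  by apply: Qext QdetV => x; rewrite GL_coords_detV.
elim: (m i) => [|e IHe]; first exact: Qc 1.
by apply: Qext (Qmul _ _ Qi IHe) => x; rewrite exprS.
Qed.

Lemma regular_ext h h' : (forall x, GL K n x -> h x = h' x) ->
  regular h -> regular h'.
Proof. by move=> e [f Ef]; exists f => x Gx; rewrite Ef ?e. Qed.

Lemma regular_const c : regular (fun=> c).
Proof. by exists c%:MP => x _; rewrite /regular_eval mevalC. Qed.

Lemma regular_add h h' : regular h -> regular h' -> regular (fun x => h x + h' x).
Proof.
move=> [f Ef] [f' Ef']; exists (f + f') => x Gx.
by rewrite -Ef // -Ef' // /regular_eval mevalD.
Qed.

Lemma regular_mul h h' : regular h -> regular h' -> regular (fun x => h x * h' x).
Proof.
move=> [f Ef] [f' Ef']; exists (f * f') => x Gx.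
by rewrite -Ef // -Ef' // /regular_eval mevalM.
Qed.

Lemma regular_opp h : regular h -> regular (fun x => - h x).
Proof.
move=> Rh; apply: regular_ext (regular_mul (regular_const (-1)) Rh) => x _.
by rewrite mulN1r.
Qed.

Lemma regular_entry i j : regular (fun x => x i j).
Proof.
by exists 'X_(entry_var i j) => x _; rewrite /regular_eval mevalXU GL_coords_entry.
Qed.

Lemma regular_detV : regular (fun x => (\det x)^-1).
Proof.
by exists 'X_detV_var => x _; rewrite /regular_eval mevalXU GL_coords_detV.
Qed.

Lemma regular_sum (I : Type) (r : seq I) (P : pred I) (F : I -> 'M[K]_n -> K) :
  (forall i, regular (F i)) -> regular (fun x => \sum_(i <- r | P i) F i x).
Proof.
move=> RF; elim: r => [|i r IHr].
  by apply: regular_ext (regular_const 0) => x _; rewrite big_nil.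
case Pi: (P i).
  by apply: regular_ext (regular_add (RF i) IHr) => x _; rewrite big_cons Pi.
by apply: regular_ext IHr => x _; rewrite big_cons Pi.
Qed.

Lemma regular_prod (I : Type) (r : seq I) (P : pred I) (F : I -> 'M[K]_n -> K) :
  (forall i, regular (F i)) -> regular (fun x => \prod_(i <- r | P i) F i x).
Proof.
move=> RF; elim: r => [|i r IHr].
  by apply: regular_ext (regular_const 1) => x _; rewrite big_nil.
case Pi: (P i).
  by apply: regular_ext (regular_mul (RF i) IHr) => x _; rewrite big_cons Pi.
by apply: regular_ext IHr => x _; rewrite big_cons Pi.
Qed.

Definition regular_mx a b (phi : 'M[K]_n -> 'M[K]_(a, b)) : Prop :=
  forall i j, regular (fun x => phi x i j).

Lemma regular_det m (phi : 'M[K]_n -> 'M[K]_m) :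
  regular_mx phi -> regular (fun x => \det (phi x)).
Proof.
move=> Rphi; apply: regular_sum => s; apply: regular_mul; first exact: regular_const.
by apply: regular_prod => i; apply: Rphi.
Qed.

Lemma regular_mx_const a b (M : 'M[K]_(a, b)) : regular_mx (fun=> M).
Proof. by move=> i j; apply: regular_const. Qed.

Lemma regular_mx_id : regular_mx id.
Proof. by move=> i j; apply: regular_entry. Qed.

Lemma regular_mx_mul a b c (phi : 'M[K]_n -> 'M[K]_(a, b))
    (psi : 'M[K]_n -> 'M[K]_(b, c)) :
  regular_mx phi -> regular_mx psi -> regular_mx (fun x => phi x *m psi x).
Proof.
move=> Rphi Rpsi i j.
apply: (@regular_ext (fun x => \sum_k phi x i k * psi x k j)).
  by move=> x _; rewrite mxE.
by apply: regular_sum => k; apply: regular_mul.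
Qed.

Lemma regular_mx_inv : regular_mx invmx.
Proof.
move=> i j.
apply: (@regular_ext (fun x => (\det x)^-1 * cofactor x j i)).
  by move=> x Gx; rewrite /invmx [x \in unitmx]Gx !mxE.
apply: regular_mul; first exact: regular_detV.
apply: regular_mul; first exact: regular_const.
apply: regular_det => a b.
by apply: regular_ext (regular_entry (lift j a) (lift i b)) => x _; rewrite !mxE.
Qed.

(** The inverse of the determinant is one of the coordinates of GL_n without
   being a matrix entry, whence the last clause. *)
Definition morphism_GL (phi : 'M[K]_n -> 'M[K]_n) : Prop :=
  [/\ forall x, GL K n x -> GL K n (phi x), regular_mx phi
    & regular (fun x => (\det (phi x))^-1)].

Lemma morphism_const y : GL K n y -> morphism_GL (fun=> y).
Proof. by move=> Gy; split=> // [i j|]; apply: regular_const. Qed.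

Lemma morphism_id : morphism_GL id.
Proof. by split=> //; [apply: regular_mx_id | apply: regular_detV]. Qed.

Lemma morphism_mul phi psi : morphism_GL phi -> morphism_GL psi ->
  morphism_GL (fun x => phi x *m psi x).
Proof.
move=> [G1 R1 D1] [G2 R2 D2]; split; last 2 first.
- exact: regular_mx_mul.
- apply: regular_ext (regular_mul D1 D2) => x Gx.
  by rewrite det_mulmx invfM.
by move=> x Gx; rewrite /GL unitmx_mul; apply/andP; split; [apply: G1|apply: G2].
Qed.

Lemma morphism_inv : morphism_GL invmx.
Proof.
split; last 2 first; first exact: regular_mx_inv.
  apply: regular_ext (regular_det regular_mx_id) => x Gx.
  by rewrite det_inv invrK.
by move=> x Gx; rewrite /GL unitmx_inv.
Qed.

Lemma regular_comp h phi : regular h -> morphism_GL phi -> regular (h \o phi).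
Proof.
move=> [f Ef] [Gphi Rphi Dphi].
apply: (@regular_ext (fun x => regular_eval f (phi x))).
  by move=> x Gx /=; rewrite Ef //; apply: Gphi.
move: f {Ef}; apply: (regular_eval_ind (Q := fun g => regular (g \o phi))) => //.
- by move=> h1 h2 e; apply: regular_ext => x _; rewrite /= e.
- exact: regular_const.
- by move=> h1 h2; apply: regular_add.
- by move=> h1 h2; apply: regular_mul.
Qed.

(** Regular functions are only determined on GL_n, so the equations are
   replaced by all the polynomials that represent them. *)
Lemma closed_zeros (Q : ('M[K]_n -> K) -> Prop) X :
    (forall h, Q h -> regular h) ->
    (forall x, X x <-> GL K n x /\ forall h, Q h -> h x = 0) ->
  Zariski_closed X.
Proof.
move=> RQ EX; exists (fun f => exists2 h, Q h &
                      forall x, GL K n x -> regular_eval f x = h x) => x.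
rewrite EX; split=> -[Gx Hx]; split=> //.
  by move=> f [h Qh ->] //; apply: Hx.
move=> h Qh; case: (RQ h Qh) => f Ef; rewrite -Ef //.
by apply: Hx; exists h.
Qed.

Lemma closed_zero h : regular h -> Zariski_closed (fun x => GL K n x /\ h x = 0).
Proof.
move=> Rh; apply: (@closed_zeros (eq h)) => [h' <- //|x].
by split=> -[Gx Hx]; split=> //; [move=> h' <- | apply: Hx].
Qed.

Lemma closed_preim phi Y : morphism_GL phi -> Zariski_closed Y ->
  Zariski_closed (fun x => GL K n x /\ Y (phi x)).
Proof.
move=> mphi [S ES].
apply: (@closed_zeros (fun h => exists2 f, S f & h = regular_eval f \o phi)).
  by move=> h [f Sf ->]; apply: regular_comp mphi; exists f.
have [Gphi _ _] := mphi.
move=> x; split=> -[Gx Hx]; split=> //.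
  by move=> h [f Sf ->]; case/ES: Hx => _; apply.
apply/ES; split; first exact: Gphi.
by move=> f Sf; apply: (Hx (regular_eval f \o phi)); exists f.
Qed.

(** The closed sets Y and Z are used through their preimages under phi, which
   are closed; they only have to separate the points of the image of X. *)
Lemma connected_preim X phi Y Z x0 :
    subset_of X (GL K n) -> Zariski_connected X -> morphism_GL phi ->
    Zariski_closed Y -> Zariski_closed Z ->
    (forall x, X x -> Y (phi x) \/ Z (phi x)) ->
    (forall x, X x -> ~ (Y (phi x) /\ Z (phi x))) ->
    X x0 -> Y (phi x0) ->
  forall x, X x -> Y (phi x).
Proof.
move=> XG [_ cX] mphi cY cZ cov dis Xx0 Yx0.
have := cX _ _ (closed_preim mphi cY) (closed_preim mphi cZ).
case.
- by move=> x Xx; case: (cov x Xx) => H; [left|right]; split=> //; apply: XG.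
- by move=> x Xx [[_ H1] [_ H2]]; apply: (dis x Xx).
- by move=> H x /H [].
- by move=> H; case: (dis x0 Xx0); split=> //; case: (H x0 Xx0).
Qed.

(** The fibre of h over one value and the union of the fibres over the other
   values are both closed. *)
Lemma finite_regular_const X h (s : seq K) :
    subset_of X (GL K n) -> Zariski_connected X -> regular h ->
    (forall x, X x -> h x \in s) ->
  forall x y, X x -> X y -> h x = h y.
Proof.
move=> XG cX Rh hs x y Xx Xy.
pose Y z := GL K n z /\ h z + - h y = 0.
pose Z z := GL K n z /\ \prod_(c <- s | c != h y) (h z + - c) = 0.
have cY : Zariski_closed Y.
  by apply: closed_zero; apply: regular_add => //; apply: regular_const.
have cZ : Zariski_closed Z.
  apply: closed_zero; apply: regular_prod => c.
  by apply: regular_add => //; apply: regular_const.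
suff [_ /eqP] : Y x by rewrite subr_eq0 => /eqP.
apply: (connected_preim (phi := id) XG cX morphism_id cY cZ _ _ Xy) => //.
- move=> z Xz; case: (eqVneq (h z) (h y)) => [e|ne].
    by left; split; [apply: XG|rewrite e subrr].
  right; split; first exact: XG.
  apply/eqP; rewrite prodf_seq_eq0; apply/hasP; exists (h z); first exact: hs.
  by rewrite ne subrr eqxx.
- move=> z Xz [[_ /eqP]]; rewrite subr_eq0 => /eqP ez [_ /eqP].
  rewrite prodf_seq_eq0 => /hasP[c _ /andP[nc]].
  by rewrite subr_eq0 ez eq_sym (negPf nc).
- by split; [apply: XG|rewrite subrr].
Qed.

End Regular.

(** * Lines in matrix space, and fields of definition *)

Section Lines.
Variables (K : closedFieldType) (n : nat).
Implicit Types (h : 'M[K]_n -> K) (X : 'M[K]_n -> Prop).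

(** A substitute for polynomial functions on matrix space: vanishing arguments
   reduce to polynomials in one variable. *)
Definition line_poly h : Prop :=
  forall v w, exists P : {poly K}, forall t, P.[t] = h (v + t *: w).

Lemma line_poly_const c : line_poly (fun=> c).
Proof. by move=> v w; exists c%:P => t; rewrite hornerC. Qed.

Lemma line_poly_add h h' : line_poly h -> line_poly h' ->
  line_poly (fun x => h x + h' x).
Proof.
move=> H H' v w; have [P EP] := H v w; have [P' EP'] := H' v w.
by exists (P + P') => t; rewrite hornerD EP EP'.
Qed.

Lemma line_poly_mul h h' : line_poly h -> line_poly h' ->
  line_poly (fun x => h x * h' x).
Proof.
move=> H H' v w; have [P EP] := H v w; have [P' EP'] := H' v w.
by exists (P * P') => t; rewrite hornerM EP EP'.
Qed.

Lemma line_poly_exp h N : line_poly h -> line_poly (fun x => h x ^+ N).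
Proof.
by move=> H v w; have [P EP] := H v w; exists (P ^+ N) => t; rewrite horner_exp EP.
Qed.

Lemma line_poly_entry i j : line_poly (fun x => x i j).
Proof.
move=> v w; exists ((v i j)%:P + w i j *: 'X) => t.
by rewrite !hornerE !mxE mulrC.
Qed.

Lemma line_poly_det : line_poly (fun x => \det x).
Proof.
move=> v w; exists (\det (map_mx polyC v + 'X *: map_mx polyC w)) => t.
rewrite -horner_evalE -det_map_mx; congr (\det _); apply/matrixP => i j.
by rewrite !mxE /= horner_evalE !hornerE.
Qed.

(** The only denominators of a regular function are powers of the determinant. *)
Lemma clear_denominators f : exists N h, line_poly h /\
  forall x, GL K n x -> h x = \det x ^+ N * regular_eval f x.
Proof.
move: f; apply: (regular_eval_ind (Q := fun g => exists N h, line_poly h /\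
  forall x, GL K n x -> h x = \det x ^+ N * g x)).
- move=> g g' e [N [h [Lh Eh]]]; exists N, h; split=> // x Gx.
  by rewrite Eh // e.
- move=> c; exists 0%N, (fun=> c); split; first exact: line_poly_const.
  by move=> x _; rewrite mul1r.
- move=> g g' [N [h [Lh Eh]]] [N' [h' [Lh' Eh']]].
  exists (N + N')%N, (fun x => \det x ^+ N' * h x + \det x ^+ N * h' x); split.
    by apply: line_poly_add; apply: line_poly_mul => //;
       apply: line_poly_exp; apply: line_poly_det.
  by move=> x Gx; rewrite Eh // Eh' // exprD; ring.
- move=> g g' [N [h [Lh Eh]]] [N' [h' [Lh' Eh']]].
  exists (N + N')%N, (fun x => h x * h' x); split; first exact: line_poly_mul.
  by move=> x Gx; rewrite Eh // Eh' // exprD; ring.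
- move=> i j; exists 0%N, (fun x => x i j); split; first exact: line_poly_entry.
  by move=> x _; rewrite mul1r.
- exists 1%N, (fun=> 1); split; first exact: line_poly_const.
  move=> x; rewrite /GL unitmxE unitfE => Gx.
  by rewrite expr1 mulfV.
Qed.

Lemma poly_vanish_everywhere (P : {poly K}) : (forall t, P.[t] = 0) -> P = 0.
Proof.
move=> P0; have [s1|] := eqVneq (size (P + 1)) 1%N; last first.
  move/closed_rootP => [t]; rewrite /root hornerD P0 add0r hornerC.
  by rewrite oner_eq0.
have [c Ec] : exists c, P = c%:P.
  have /size1_polyC E1 : (size (P + 1)%R <= 1)%N by rewrite s1.
  by exists ((P + 1)`_0 - 1); rewrite polyCB -E1 addrK.
by move: (P0 0); rewrite Ec hornerC => ->; rewrite polyC0.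
Qed.

(** X is irreducible: a line through two of its points lies in X except for the
   finitely many parameters where the determinant vanishes, and a nonzero
   polynomial on the line cannot vanish at all the remaining ones. *)
Lemma linear_connected X :
    subset_of X (GL K n) -> (exists x, X x) ->
    (forall x y t, X x -> X y -> GL K n (x + t *: (y - x)) ->
                   X (x + t *: (y - x))) ->
  Zariski_connected X.
Proof.
move=> XG X0 Xline; split=> // Y Z [SY EY] [SZ EZ] cov _.
have [|nY] := classic (subset_of X Y); first by left.
have [|nZ] := classic (subset_of X Z); first by right.
exfalso.
have separate W S : (forall x, W x <-> GL K n x /\
      forall f, S f -> regular_eval f x = 0) -> ~ subset_of X W ->
    exists x f, [/\ X x, S f & regular_eval f x != 0].
  move=> EW nW; apply: NNPP => H; apply: nW => x Xx.
  apply/EW; split; first exact: XG.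
  move=> f Sf; apply/eqP; apply: contraT => ne; case: H.
  by exists x, f.
have {nY} [x [f [Xx Sf fx]]] := separate Y SY EY nY.
have {nZ} [y [g [Xy Sg gy]]] := separate Z SZ EZ nZ.
have [N [F [LF EF]]] := clear_denominators f.
have [N' [G [LG EG]]] := clear_denominators g.
have unit_det z : X z -> \det z != 0 by move/XG; rewrite /GL unitmxE unitfE.
have [PF EPF] := LF x (y - x); have [PG EPG] := LG x (y - x).
have [D ED] := line_poly_det x (y - x).
have x0 : x + 0 *: (y - x) = x by rewrite scale0r addr0.
have y1 : x + 1 *: (y - x) = y by rewrite scale1r addrC subrK.
have PF0 : PF != 0.
  apply/eqP => P0; have := EPF 0; rewrite P0 horner0 x0 EF; last exact: XG.
  by move/esym/eqP; rewrite mulf_eq0 (negPf fx) expf_eq0 (negPf (unit_det _ Xx)) andbF.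
have PG0 : PG != 0.
  apply/eqP => P0; have := EPG 1; rewrite P0 horner0 y1 EG; last exact: XG.
  by move/esym/eqP; rewrite mulf_eq0 (negPf gy) expf_eq0 (negPf (unit_det _ Xy)) andbF.
have D0 : D != 0.
  apply/eqP => P0; have := ED 0; rewrite P0 horner0 x0.
  by move/esym/eqP; rewrite (negPf (unit_det _ Xx)).
suff : PF * PG * D = 0.
  by move/eqP; rewrite !mulf_eq0 (negPf PF0) (negPf PG0) (negPf D0).
apply: poly_vanish_everywhere => t; rewrite !hornerM EPF EPG ED.
have [->|dt] := eqVneq (\det (x + t *: (y - x))) 0; first by rewrite mulr0.
have Gt : GL K n (x + t *: (y - x)) by rewrite /GL unitmxE unitfE.
rewrite EF // EG //; case: (cov _ (Xline _ _ _ Xx Xy Gt)).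
  by move/EY => [_ /(_ f Sf) ->]; rewrite mulr0 !mul0r.
by move/EZ => [_ /(_ g Sg) ->]; rewrite !mulr0 mul0r.
Qed.

End Lines.

Section FieldOfDefinition.
Variables (k : fieldType) (K : closedFieldType) (iota : {rmorphism k -> K}).

(** Among all the ways of writing a combination of polynomials over k with
   coefficients in K, a shortest one has coefficients linearly independent over
   k.  This is what replaces a basis of K over k. *)
Lemma independent_decomposition N (J : {mpoly k[N]} -> Prop) :
    (forall f g, J f -> J g -> J (f + g)) -> (forall c f, J f -> J (c *: f)) ->
  forall r : seq (K * {mpoly k[N]}), (forall q, q \in r -> J q.2) ->
  exists d (c : 'I_d -> K) (g : 'I_d -> {mpoly k[N]}),
    [/\ forall i, J (g i),
        \sum_(q <- r) q.1 *: map_mpoly iota q.2 =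
        \sum_i c i *: map_mpoly iota (g i)
      & forall b : 'I_d -> k, \sum_i iota (b i) * c i = 0 -> forall i, b i = 0].
Proof.
move=> JD JZ r Jr.
suff main d (c : 'I_d -> K) (g : 'I_d -> {mpoly k[N]}) : (forall i, J (g i)) ->
  exists d' (c' : 'I_d' -> K) (g' : 'I_d' -> {mpoly k[N]}),
    [/\ forall i, J (g' i),
        \sum_i c i *: map_mpoly iota (g i) = \sum_i c' i *: map_mpoly iota (g' i)
      & forall b : 'I_d' -> k, \sum_i iota (b i) * c' i = 0 -> forall i, b i = 0].
  rewrite (big_nth (0, 0)) big_mkord.
  apply: (main _ (fun i : 'I_(size r) => (nth (0, 0) r i).1)
            (fun i : 'I_(size r) => (nth (0, 0) r i).2)).
  by move=> i; apply: Jr; apply: mem_nth.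
elim: d c g => [|d IHd] c g Jg; first by exists 0%N, c, g; split=> // b _ [].
have [ind|] := classic (forall b : 'I_d.+1 -> k,
    \sum_i iota (b i) * c i = 0 -> forall i, b i = 0); first by exists d.+1, c, g.
move=> dep.
have [b [j [rel bj]]] : exists b j, \sum_i iota (b i) * c i = 0 /\ b j != 0.
  apply: NNPP => H; apply: dep => b rel j; apply/eqP; apply: contraT => bj.
  by case: H; exists b, j.
pose e i := b (lift j i) / b j.
have [|d' [c' [g' [Jg' E ind]]]] := IHd (fun i => c (lift j i))
    (fun i => g (lift j i) - e i *: g j).
  by move=> i; apply: (JD) => //; rewrite -scaleNr; apply: JZ.
exists d', c', g'; split=> //; rewrite -E.
have cj : c j = - \sum_i iota (e i) * c (lift j i).
  have ubj : iota (b j) != 0 by rewrite fmorph_eq0.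
  apply: (mulfI ubj); move: rel; rewrite (bigD1_ord j) //=.
  move/eqP; rewrite addr_eq0 => /eqP ->; rewrite mulrN mulr_sumr; congr (- _).
  apply: eq_bigr => i _.
  by rewrite mulrA -rmorphM /e mulrCA mulfV // mulr1.
rewrite (bigD1_ord j) //= cj scaleNr scaler_suml -sumrN -big_split /=.
apply: eq_bigr => i _; rewrite addrC raddfB /= scalerBr map_mpolyZ scalerA.
by rewrite [c _ * _]mulrC.
Qed.

Variable n : nat.

Lemma regular_eval_map (g : {mpoly k[n * n + 1]}) (M : 'M[k]_n) :
  exists e, regular_eval (map_mpoly iota g) (map_mx iota M) = iota e.
Proof.
have coordk i : exists e, GL_coords (map_mx iota M) i = iota e.
  case: (coord_varP i) => [[a [b ->]]|->].
    by exists (M a b); rewrite GL_coords_entry mxE.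
  by exists (\det M)^-1; rewrite GL_coords_detV det_map_mx fmorphV.
rewrite /regular_eval; elim/mpolyind: g => [|c m g _ _ [e IH]].
  by exists 0; rewrite raddf0 meval0 rmorph0.
have [e' E'] : exists e', ('X_[m]).@[GL_coords (map_mx iota M)] = iota e'.
  rewrite mevalX; elim: (index_enum _) => [|i s [e' E']].
    by exists 1; rewrite big_nil rmorph1.
  have [a Ea] := coordk i.
  by exists (a ^+ m i * e'); rewrite big_cons E' Ea rmorphM rmorphXn.
exists (c * e' + e).
by rewrite raddfD /= map_mpolyZ map_mpolyX mevalD mevalZ IH E' rmorphD rmorphM.
Qed.

(** The K-subspace spanned by a set E of matrices over k. *)
Inductive extended_span (E : 'M[k]_n -> Prop) : 'M[K]_n -> Prop :=
| extended_span0 : extended_span E 0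
| extended_spanS x c M : extended_span E x -> E M ->
    extended_span E (x + c *: map_mx iota M).

Variable u : nat -> k.
Hypothesis inj_u : injective u.

(** On a line in the direction of a matrix of E, the function h is polynomial in
   the parameter; it vanishes when the parameter is in k, which is infinite, so
   it vanishes identically.  The K-coefficients can thus be introduced one at a
   time. *)
Lemma vanish_extended_span (E : 'M[k]_n -> Prop) (h : 'M[K]_n -> K) :
    line_poly h -> E 0 ->
    (forall c M M', E M -> E M' -> E (c *: M + M')) ->
    (forall M, E M -> h (map_mx iota M) = 0) ->
  forall x, extended_span E x -> h x = 0.
Proof.
move=> Lh E0 EL h0 x Ex.
suff main y : extended_span E y -> forall M, E M -> h (y + map_mx iota M) = 0.
  by rewrite -[x]addr0 -(map_mx0 iota); apply: main.
elim=> [|{Ex}{}x c M0 _ IH EM0] M EM; first by rewrite add0r h0.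
have [P EP] := Lh (x + map_mx iota M) (map_mx iota M0).
suff P0 : P = 0 by rewrite addrAC -EP P0 horner0.
apply: (@roots_geq_poly_eq0 _ _ (mkseq (fun i => iota (u i)) (size P))).
- apply/allP => _ /mapP[i _ ->]; rewrite rootE EP addrAC.
  rewrite -map_mxZ -addrA -map_mxD; apply/eqP/IH.
  by apply: EL.
- by rewrite map_inj_uniq ?iota_uniq // => i j /fmorph_inj/inj_u.
- by rewrite size_mkseq.
Qed.

(** The points over k are dense in X.  Write f, which vanishes on X, as a sum of
   c_i g_i with g_i over k and the c_i linearly independent over k: at a point
   over k the relation gives the vanishing of each g_i, which then extends to
   the whole of X by density. *)
Lemma defined_over_linear (E : 'M[k]_n -> Prop) (X : 'M[K]_n -> Prop) :
    E 0 -> (forall c M M', E M -> E M' -> E (c *: M + M')) ->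
    (forall x, X x <-> GL K n x /\ extended_span E x) ->
  defined_over iota X.
Proof.
move=> E0 EL EX f fX.
have [|||d [c [g [_ Ef ind]]]] := @independent_decomposition _ (fun=> True) _ _
  [seq (f@_m, 'X_[m]) | m <- msupp f] => //.
have {}Ef : f = \sum_i c i *: map_mpoly iota (g i).
  rewrite -Ef big_map {1}[f]mpolyE; apply: eq_bigr => m _.
  by rewrite map_mpolyX.
exists [seq ((c i)%:MP, g i) | i <- enum 'I_d]; split; last first.
  rewrite big_map big_enum {1}Ef; apply: eq_bigr => i _ /=.
  by rewrite mul_mpolyC.
move=> _ /mapP[i _ ->] /= x Xx.
have [Gx Ex] := (EX x).1 Xx.
have [N [h [Lh Eh]]] := clear_denominators (map_mpoly iota (g i)).
have dx : \det x != 0 by move: Gx; rewrite /GL unitmxE unitfE.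
suff H : h x * \det x = 0.
  move/eqP: H; rewrite Eh // !mulf_eq0 expf_eq0 (negPf dx) andbF /= orbF.
  by move/eqP.
apply: (vanish_extended_span (h := fun x => h x * \det x) _ E0 EL _ Ex).
  by apply: line_poly_mul => //; apply: line_poly_det.
move=> M EM; have [->|dM] := eqVneq (\det (map_mx iota M)) 0.
  by rewrite mulr0.
have GM : GL K n (map_mx iota M) by rewrite /GL unitmxE unitfE.
rewrite Eh //; suff -> : regular_eval (map_mpoly iota (g i)) (map_mx iota M) = 0.
  by rewrite mulr0 mul0r.
have XM : X (map_mx iota M).
  apply/EX; split=> //; rewrite -[map_mx _ _]scale1r -[_ *: _]add0r.
  by apply: extended_spanS => //; apply: extended_span0.
have [b Eb] : exists b : 'I_d -> k, forall j,
    regular_eval (map_mpoly iota (g j)) (map_mx iota M) = iota (b j).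
  exact: (fin_all_exists (fun j => regular_eval_map (g j) M)).
rewrite Eb (ind b) ?rmorph0 //.
have := fX _ XM; rewrite /regular_eval Ef raddf_sum /= => fM0; apply: etrans fM0.
by apply: eq_bigr => j _; rewrite mevalZ -Eb mulrC.
Qed.

End FieldOfDefinition.

(** * Derived subgroups *)

(** A subspace given by a predicate is the row space of a matrix of maximal
   rank among those whose rows satisfy the predicate. *)
Lemma subspace_mx (F : fieldType) m (S : 'rV[F]_m -> Prop) :
    S 0 -> (forall c v w, S v -> S w -> S (c *: v + w)) ->
  exists W : 'M[F]_m, forall v, S v <-> (v <= W)%MS.
Proof.
move=> S0 SL.
suff main d (W : 'M[F]_m) : (m - \rank W <= d)%N ->
    (forall v, (v <= W)%MS -> S v) ->
    exists W' : 'M[F]_m, forall v, S v <-> (v <= W')%MS.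
  by apply: (main _ 0 (leqnn _)) => v; rewrite submx0 => /eqP ->.
elim: d W => [|d IHd] W leWd SW;
    have [WS|nWS] := classic (forall v, S v -> (v <= W)%MS);
  try by exists W => v; split; [apply: WS | apply: SW].
  case: nWS => v _; apply: submx_full.
  by rewrite /row_full eqn_leq rank_leq_col /= -subn_eq0 -leqn0.
have [v [Sv nv]] : exists v, S v /\ ~~ (v <= W)%MS.
  apply: NNPP => H; apply: nWS => v Sv; apply: contraT => nv.
  by case: H; exists v.
apply: (IHd (W + v)%MS) => [|v' /sub_addsmxP[[u1 u2] /= ->]].
  have ltr : (\rank W < \rank (W + v))%N.
    apply: rank_ltmx; rewrite ltmxE addsmxSl /=.
    by apply: contra nv; apply: submx_trans; apply: addsmxSr.
  by rewrite -ltnS; apply: leq_trans leWd; apply: ltn_sub2l => //;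
     apply: leq_trans ltr _; apply: rank_leq_col.
rewrite (mx11_scalar u2) mul_scalar_mx addrC.
by apply: SL Sv _; apply: SW; apply: submxMl.
Qed.

Section Derived.
Variables (K : closedFieldType) (n : nat).
Implicit Types (G H X : 'M[K]_n -> Prop).

Definition commutator (x y : 'M[K]_n) := invmx x *m invmx y *m x *m y.

Lemma GL_subgroup : is_subgroup (GL K n).
Proof.
split=> //; first exact: unitmx1.
- by move=> x y Gx Gy; rewrite /GL unitmx_mul; apply/andP; split.
- by move=> x Gx; rewrite /GL unitmx_inv.
Qed.

Lemma subgroup_commutator G x y : is_subgroup G -> G x -> G y ->
  G (commutator x y).
Proof. by move=> [_ _ GM GV] Gx Gy; do 3![apply: (GM _ _ _ _) => //]; exact: GV. Qed.

Lemma generated_is_subgroup X : subset_of X (GL K n) ->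
  is_subgroup (generated_subgroup X).
Proof.
move=> XG; split.
- by move=> x; apply; [apply: GL_subgroup | apply: XG].
- by move=> H [].
- by move=> x y Hx Hy H sH XH; case: (sH) => _ _ HM _; apply: HM; [apply: Hx|apply: Hy].
- by move=> x Hx H sH XH; case: (sH) => _ _ _ HV; apply: HV; apply: Hx.
Qed.

Lemma derived_commutator H x y : H x -> H y -> derived_subgroup H (commutator x y).
Proof. by move=> Hx Hy G _; apply; exists x, y. Qed.

Lemma derived_min H G : is_subgroup G ->
  (forall x y, H x -> H y -> G (commutator x y)) -> subset_of (derived_subgroup H) G.
Proof.
move=> sG HG x; apply => //; move=> z [y [y' [Hy Hy' ->]]]; exact: HG.
Qed.

Lemma derived_is_subgroup G : is_subgroup G -> is_subgroup (derived_subgroup G).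
Proof.
move=> sG; apply: generated_is_subgroup => z [x [y [Gx Gy ->]]].
by case: (sG) => GG _ _ _; apply: GG; apply: subgroup_commutator.
Qed.

Lemma derived_sub G : is_subgroup G -> subset_of (derived_subgroup G) G.
Proof. by move=> sG; apply: derived_min => // x y; apply: subgroup_commutator. Qed.

Lemma derived_mono G H : subset_of G H ->
  subset_of (derived_subgroup G) (derived_subgroup H).
Proof.
move=> GH z Gz L sL HL; apply: Gz => // c [x [y [Gx Gy ->]]].
by apply: HL; exists x, y; split=> //; apply: GH.
Qed.

(** g x g^-1 = x [x, g^-1]. *)
Lemma derived_normal G g x : is_subgroup G -> G g -> derived_subgroup G x ->
  derived_subgroup G (g *m x *m invmx g).
Proof.
move=> sG Gg Dx; have Gx := derived_sub sG Dx.
have [GG _ GM GV] := sG; have [DG _ DM DV] := derived_is_subgroup sG.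
suff -> : g *m x *m invmx g = x *m commutator x (invmx g).
  by apply: DM => //; apply: derived_commutator => //; apply: GV.
by rewrite /commutator invmxK !mulmxA mulmxV ?mul1mx //; apply: GG.
Qed.

(** Multiplication by commutators on the right does not leave a clopen part: the
   map y |-> w [x, y] sends the connected group G to its derived subgroup, and
   y = 1 is sent to w. *)
Lemma connected_derived G : is_subgroup G -> Zariski_connected G ->
  Zariski_connected (derived_subgroup G).
Proof.
move=> sG cG; have [GG G1 GM GV] := sG.
have sD := derived_is_subgroup sG; have [DG D1 DM DV] := sD.
split; first by exists 1%:M.
move=> Y Z cY cZ cov dis.
have step W W' w x y : Zariski_closed W -> Zariski_closed W' ->
    (forall x, derived_subgroup G x -> W x \/ W' x) ->
    (forall x, derived_subgroup G x -> ~ (W x /\ W' x)) ->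
    derived_subgroup G w -> W w -> G x -> G y -> W (w *m commutator x y).
  move=> cW cW' covW disW Dw Ww Gx Gy.
  pose phi z := w *m (invmx x *m invmx z *m x *m z).
  have mphi : morphism_GL phi.
    apply: morphism_mul; first by apply: morphism_const; apply: DG.
    apply: morphism_mul; last exact: morphism_id.
    apply: morphism_mul; last by apply: morphism_const; apply: GG.
    apply: morphism_mul; last exact: morphism_inv.
    by apply: morphism_const; apply: GG; apply: GV.
  have Dphi z : G z -> derived_subgroup G (phi z).
    by move=> Gz; apply: DM => //; apply: derived_commutator.
  apply: (connected_preim GG cG mphi cW cW' _ _ G1 _ Gy).
  - by move=> z Gz; apply: covW; apply: Dphi.
  - by move=> z Gz; apply: disW; apply: Dphi.
  - by rewrite /phi invmx1 !mulmx1 mulVmx ?mulmx1 //; apply: GG.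
have main W W' : Zariski_closed W -> Zariski_closed W' ->
    (forall x, derived_subgroup G x -> W x \/ W' x) ->
    (forall x, derived_subgroup G x -> ~ (W x /\ W' x)) ->
    W 1%:M -> subset_of (derived_subgroup G) W.
  move=> cW cW' covW disW W1 z Dz.
  (* Right multiplication by an element of S preserves the clopen part W. *)
  pose S g := derived_subgroup G g /\
    forall w, derived_subgroup G w -> (W w <-> W (w *m g)).
  have sS : is_subgroup S.
    split.
    - by move=> x [Dx _]; apply: DG.
    - by split=> [|w _]; rewrite ?mulmx1.
    - move=> x y [Dx Sx] [Dy Sy]; split; first exact: DM.
      move=> w Dw; apply: (iff_trans (Sx w Dw)); rewrite mulmxA.
      by apply: Sy; apply: DM.
    - move=> x [Dx Sx]; split; first exact: DV.
      move=> w Dw; apply: iff_sym.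
      have := Sx _ (DM _ _ Dw (DV _ Dx)); rewrite mulmxKV //; exact: DG.
  have DS : subset_of (derived_subgroup G) S.
    apply: derived_min => // x y Gx Gy; have Dc := derived_commutator Gx Gy.
    split=> // w Dw; split=> [Ww|Wwc]; first exact: (step W W').
    case: (covW w Dw) => // W'w; case: (disW (w *m commutator x y)).
      exact: DM.
    split=> //; apply: (step W' W) => //.
      by move=> t /covW[]; [right|left].
    by move=> t /disW H [H1 H2]; apply: H.
  by have [_ /(_ _ D1)] := DS z Dz; rewrite mul1mx => <-.
case: (cov _ D1) => H1.
  by left; apply: (main Y Z).
right; apply: (main Z Y) => //.
  by move=> t /cov[]; [right|left].
by move=> t /dis H [H2 H3]; apply: H.
Qed.

End Derived.

(** * The Lie-Kolchin theorem *)

Lemma char_poly_rootP (K : closedFieldType) m (M : 'M[K]_m) :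
  (0 < m)%N -> exists a, root (char_poly M) a.
Proof.
move=> m0; apply/closed_rootP; rewrite size_char_poly.
by case: m m0 {M}.
Qed.

Lemma roots_finite (K : closedFieldType) (P : {poly K}) : P != 0 ->
  exists s : seq K, forall a, root P a -> a \in s.
Proof.
move=> P0; have [s Es] := closed_field_poly_normal P; exists s => a.
by rewrite Es rootZ ?lead_coef_eq0 // root_prod_XsubC.
Qed.

Section LieKolchin.
Variables (K : closedFieldType) (n : nat).
Implicit Types (G : 'M[K]_n -> Prop).

Definition representation G m (rho : 'M[K]_n -> 'M[K]_m) : Prop :=
  [/\ regular_mx rho, rho 1%:M = 1%:M
    & forall x y, G x -> G y -> rho (x *m y) = rho x *m rho y].

(** Induction on the derived length of G and on the dimension of W, which may
   be assumed to have no proper nonzero invariant subspace.  The derived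
   subgroup D has an eigenvector w in W, with character chi.  For x in D,
   the value chi (g x g^-1) is an eigenvalue of rho x, so it takes finitely many
   values for g in the connected group G and is constant.  Hence the
   eigenspace of chi in W is stable under G, and equal to W.  The elements of D
   have determinant 1 on W, so chi is a root of unity of bounded order, and is
   trivial because D is connected.  Therefore G acts on W by commuting matrices,
   which are scalar by irreducibility. *)
Lemma Lie_Kolchin_eigenvector l G m (rho : 'M[K]_n -> 'M[K]_m) (W : 'M[K]_m) :
    is_subgroup G -> Zariski_connected G ->
    (forall x, iter l (@derived_subgroup K n) G x -> x = 1%:M) ->
    representation G rho ->
    W != 0 -> (forall g, G g -> (W *m rho g <= W)%MS) ->
  exists v : 'rV[K]_m, [/\ v != 0, (v <= W)%MS &
    forall g, G g -> exists a, v *m rho g = a *: v].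
Proof.
elim: l G m rho W => [|l IHl] G m rho W sG cG Gl rG W0 WG.
  exists (nz_row W); split; first by rewrite nz_row_eq0.
    exact: nz_row_sub.
  move=> g Gg; exists 1; rewrite (Gl g Gg); case: rG => _ -> _.
  by rewrite mulmx1 scale1r.
have [d] := ubnP (\rank W); elim: d W W0 WG => // d IHd W W0 WG ltWd.
have [[U [U0 UW nWU UG]]|irr] := classic (exists U : 'M[K]_m,
    [/\ U != 0, (U <= W)%MS, ~~ (W <= U)%MS &
        forall g, G g -> (U *m rho g <= U)%MS]).
  have [|v [v0 vU vG]] := IHd U U0 UG.
    by rewrite -ltnS; apply: leq_trans ltWd; rewrite ltnS; apply: rank_ltmx;
       rewrite ltmxE UW.
  by exists v; split=> //; apply: submx_trans vU UW.
(* Minimality of W, for subspaces given by predicates as eigenspaces are. *)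
have irreducible (S : 'rV[K]_m -> Prop) : S 0 ->
    (forall c v w, S v -> S w -> S (c *: v + w)) ->
    (forall v, S v -> (v <= W)%MS) -> (exists2 v, S v & v != 0) ->
    (forall g v, G g -> S v -> S (v *m rho g)) ->
    forall v, (v <= W)%MS -> S v.
  move=> S0 SL SW [w Sw w0] SG v vW; have [U EU] := subspace_mx S0 SL.
  apply/EU; apply: submx_trans vW _; apply: contraT => nWU; case: irr; exists U.
  split=> //.
  - apply: contraNneq w0 => U0; move/EU: Sw; rewrite U0 submx0.
    by move/eqP->.
  - by apply/row_subP => i; apply: SW; apply/EU; apply: row_sub.
  - move=> g Gg; apply/row_subP => i; rewrite row_mul; apply/EU.
    by apply: SG => //; apply/EU; apply: row_sub.
have [Rrho rho1 rhoM] := rG.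
have [GG G1 GM GV] := sG.
have sD := derived_is_subgroup sG; have cD := connected_derived sG cG.
have DsG := derived_sub sG; have [DG D1 _ _] := sD.
have [||||w [w0 wW wD]] := IHl (derived_subgroup G) m rho W sD cD.
- by rewrite -iterSr.
- by split=> // x y /DsG Gx /DsG Gy; apply: rhoM.
- by [].
- by move=> g /DsG; apply: WG.
have [i wi] : exists i, w 0 i != 0 by apply/rV0Pn.
pose chi x := (w *m rho x) 0 i / w 0 i.
have chiE x : derived_subgroup G x -> w *m rho x = chi x *: w.
  move=> /wD[a Ea]; rewrite /chi Ea mxE mulfK //.
have Rchi : regular chi.
  apply: regular_mul; last exact: regular_const.
  by apply: regular_mx_mul => //; apply: regular_mx_const.
have rhoV g : G g -> rho g *m rho (invmx g) = 1%:M.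
  by move=> Gg; rewrite -rhoM ?mulmxV //; [apply: GG | apply: GV].
have rho_free g (v : 'rV[K]_m) : G g -> v != 0 -> v *m rho g != 0.
  move=> Gg; apply: contraNneq => e.
  by rewrite -[v]mulmx1 -(rhoV g Gg) mulmxA e mul0mx.
have conj_rho g x : G g -> derived_subgroup G x ->
    rho g *m rho x = rho (g *m x *m invmx g) *m rho g.
  move=> Gg Dx; have Gx := DsG _ Dx.
  rewrite -!rhoM //; last by do !apply: (GM _ _ _ _) => //; apply: GV.
  by rewrite mulmxKV //; apply: GG.
have chi_conj g x : G g -> derived_subgroup G x ->
    chi (g *m x *m invmx g) = chi x.
  move=> Gg Dx.
  have [s Hs] : exists s : seq K, forall a, root (char_poly (rho x)) a -> a \in s.
    by apply: roots_finite; apply: monic_neq0; apply: char_poly_monic.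
  have mphi : morphism_GL (fun g => g *m x *m invmx g).
    apply: morphism_mul; last exact: morphism_inv.
    by apply: morphism_mul; [apply: morphism_id | apply: morphism_const; apply: DG].
  have := finite_regular_const (s := s) GG cG (regular_comp Rchi mphi) _ Gg G1.
  rewrite /= invmx1 mulmx1 mul1mx; apply=> h Gh /=; apply: Hs; rewrite -eigenvalue_root_char.
  apply/eigenvalueP; exists (w *m rho h); last exact: rho_free.
  rewrite -(mulmxA w) conj_rho // (mulmxA w) chiE ?scalemxAl //.
  exact: derived_normal.
have scalarD (v : 'rV[K]_m) x : (v <= W)%MS -> derived_subgroup G x -> v *m rho x = chi x *: v.
  move=> vW; move: x.
  pose S (v : 'rV[K]_m) := (v <= W)%MS /\
     forall x, derived_subgroup G x -> v *m rho x = chi x *: v.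
  suff : S v by case.
  apply: irreducible vW.
  - by split; [apply: sub0mx | move=> x _; rewrite mul0mx scaler0].
  - move=> c v1 v2 [H1 E1] [H2 E2]; split.
      by apply: addmx_sub => //; apply: scalemx_sub.
    by move=> x Dx; rewrite mulmxDl -scalemxAl E1 // E2 // scalerDr !scalerA mulrC.
  - by move=> v1 [].
  - by exists w.
  - move=> g v1 Gg [H1 E1]; split.
      by apply: submx_trans (WG g Gg); apply: submxMr.
    move=> x Dx; rewrite -(mulmxA v1) conj_rho // (mulmxA v1) E1; last exact: derived_normal.
    by rewrite chi_conj // scalemxAl.
pose B := row_base W; pose r := \rank W.
have r0 : (0 < r)%N by rewrite lt0n mxrank_eq0.
have fB : row_free B := row_base_free W.
(* R is the action on W in coordinates, used for its determinant. *)
pose R g : 'M[K]_r := B *m rho g *m pinvmx B.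
have RB g : G g -> R g *m B = B *m rho g.
  move=> Gg; apply: mulmxKpV; rewrite !eq_row_base.
  by apply: submx_trans (WG g Gg); apply: submxMr; rewrite eq_row_base.
have RM g h : G g -> G h -> R (g *m h) = R g *m R h.
  move=> Gg Gh; apply: (row_free_inj fB); rewrite (RB (g *m h)) ?rhoM //; last exact: GM.
  by rewrite -(mulmxA (R g)) (RB h) // (mulmxA (R g)) (RB g) // mulmxA.
have R1 : R 1%:M = 1%:M.
  by apply: (row_free_inj fB); rewrite RB // rho1 mulmx1 mul1mx.
have RV g : G g -> \det (R (invmx g)) * \det (R g) = 1.
  by move=> Gg; rewrite -det_mulmx -RM ?mulVmx ?R1 ?det1 //; [apply: GG|apply: GV].
have detD x : derived_subgroup G x -> \det (R x) = 1.
  move=> Dx; suff [] : G x /\ \det (R x) = 1 by [].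
  move: x Dx; apply: (@derived_min K n G (fun x => G x /\ \det (R x) = 1)).
    split.
    - by move=> x [/GG].
    - by split=> //; rewrite R1 det1.
    - move=> x y [Gx dx] [Gy dy]; split; first exact: GM.
      by rewrite RM // det_mulmx dx dy mulr1.
    - move=> x [Gx dx]; split; first exact: GV.
      by rewrite -[LHS]mulr1 -dx RV.
  move=> x y Gx Gy; split; first exact: subgroup_commutator.
  have Gx' := GV _ Gx; have Gy' := GV _ Gy.
  have G2 := GM _ _ Gx' Gy'; have G3 := GM _ _ G2 Gx.
  rewrite /commutator !RM // !det_mulmx.
  by rewrite -[RHS]mulr1 -{1}(RV x Gx) -(RV y Gy); ring.
have chi_trivial x : derived_subgroup G x -> chi x = 1.
  have chir y : derived_subgroup G y -> chi y ^+ r = 1.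
    move=> Dy; rewrite -det_scalar -(detD y Dy); congr (\det _).
    apply: (row_free_inj fB); rewrite RB; last exact: DsG.
    rewrite mul_scalar_mx; apply/row_matrixP => j.
    rewrite row_mul scalarD //; first by rewrite linearZ.
    by rewrite -(eq_row_base W); apply: row_sub.
  have [s Hs] : exists s : seq K, forall a, root ('X^r - 1) a -> a \in s.
    by apply: roots_finite; rewrite -size_poly_eq0 size_XnsubC.
  move=> Dx; rewrite (finite_regular_const (s := s) DG cD Rchi _ Dx D1).
    by rewrite /chi rho1 mulmx1 mulfV.
  by move=> y Dy; apply: Hs; rewrite rootE !hornerE chir // subrr.
have abelian (v : 'rV[K]_m) g h : (v <= W)%MS -> G g -> G h ->
    v *m rho g *m rho h = v *m rho h *m rho g.
  move=> vW Gg Gh; rewrite -!mulmxA -!rhoM //.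
  have Gg' := GV _ Gg; have Gh' := GV _ Gh.
  have -> : g *m h = commutator (invmx g) (invmx h) *m (h *m g).
    by rewrite /commutator !invmxK !mulmxA mulmxKV ?mulmxKV //; apply: GG.
  have Dc : derived_subgroup G (commutator (invmx g) (invmx h)).
    exact: derived_commutator.
  rewrite (rhoM _ _ (DsG _ Dc) (GM _ _ Gh Gg)) mulmxA.
  by rewrite (scalarD v _ vW Dc) chi_trivial // scale1r.
exists (nz_row W); split; first by rewrite nz_row_eq0.
  exact: nz_row_sub.
move=> g Gg; have [a ra] := char_poly_rootP (R g) r0.
move: ra; rewrite -eigenvalue_root_char => /eigenvalueP[u Eu u0].
exists a; move: (nz_row_sub W); move: (nz_row W) => v vW.
pose S (v : 'rV[K]_m) := (v <= W)%MS /\ v *m rho g = a *: v.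
suff : S v by case.
apply: irreducible vW.
- by split; [apply: sub0mx | rewrite mul0mx scaler0].
- move=> c v1 v2 [H1 E1] [H2 E2]; split.
    by apply: addmx_sub => //; apply: scalemx_sub.
  by rewrite mulmxDl -scalemxAl E1 // E2 // scalerDr !scalerA mulrC.
- by move=> v1 [].
- exists (u *m B); last first.
    by apply: contraNneq u0 => e; apply/eqP; apply: (row_free_inj fB); rewrite /= e mul0mx.
  split; first by rewrite -(eq_row_base W); apply: submxMl.
  by rewrite -mulmxA -RB // mulmxA Eu scalemxAl.
- move=> h v1 Gh [H1 E1]; split.
    by apply: submx_trans (WG h Gh); apply: submxMr.
  by rewrite abelian // E1 scalemxAl.
Qed.

(** The eigenvector is completed to a basis; the remaining diagonal block is a
   representation of smaller degree. *)
Theorem Lie_Kolchin G m (rho : 'M[K]_n -> 'M[K]_m) :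
    is_subgroup G -> Zariski_connected G -> solvable_subgroup G ->
    representation G rho ->
  exists2 P, P \in unitmx &
    forall g, G g -> is_trig_mx (P *m rho g *m invmx P).
Proof.
move=> sG cG [l Gl]; elim: m rho => [|m IHm] rho rG.
  by exists 1%:M; [apply: unitmx1 | move=> g _; apply/is_trig_mxP => -[]].
have [||v [v0 _ vG]] := Lie_Kolchin_eigenvector (W := 1%:M) sG cG Gl rG.
- by rewrite oner_eq0.
- by move=> g _; apply: submx1.
have [Rrho rho1 rhoM] := rG.
(* The first row of P0 is a nonzero multiple of v. *)
pose P0 : 'M_(1 + m) := row_ebase v; have uP0 : P0 \in unitmx := row_ebase_unit v.
pose e0 : 'M[K]_(1, 1 + m) := row_mx 1%:M 0.
pose rho1' g : 'M_(1 + m) := P0 *m rho g *m invmx P0.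
have e0G g : G g -> exists a, e0 *m rho1' g = a *: e0.
  move=> Gg; have [a Ea] := vG g Gg; exists a.
  have rv : \rank v = 1%N by rewrite rank_rV v0.
  have [c c0 Ec] : exists2 c : K, c != 0 & v = c *: (e0 *m P0).
    exists (col_ebase v 0 0).
      have := col_ebase_unit v; rewrite (mx11_scalar (col_ebase v)).
      by rewrite unitmxE det_scalar1 unitfE mxE eqxx mulr1n.
    rewrite -mul_scalar_mx -mx11_scalar -{1}(mulmx_ebase v) rv mulmxA.
    by rewrite /e0 -pid_mx_row.
  have Ee : e0 *m P0 = c^-1 *: v by rewrite Ec scalerA mulVf // scale1r.
  rewrite /rho1' !mulmxA Ee -!scalemxAl Ea -scalemxAl scalerA mulrC -scalerA.
  by rewrite scalemxAl -Ee mulmxK.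
have block g : G g -> exists a C D, rho1' g = block_mx a%:M 0 C D.
  move=> Gg; have [a] := e0G g Gg; rewrite -[rho1' g]submxK /e0 mul_row_block.
  rewrite !mul0mx !addr0 !mul1mx scale_row_mx scaler0 => /eq_row_mx[-> ->].
  by exists a, (dlsubmx (rho1' g)), (drsubmx (rho1' g)); rewrite scalemx1.
pose rho2 g : 'M_m := drsubmx (rho1' g).
have rep2 : representation G rho2.
  split.
  - move=> i j; apply: (@regular_ext _ _ (fun x => rho1' x (rshift 1 i) (rshift 1 j))).
      by move=> x _; rewrite /rho2 !mxE.
    apply: regular_mx_mul; last exact: regular_mx_const.
    by apply: regular_mx_mul => //; apply: regular_mx_const.
  - by rewrite /rho2 /rho1' rho1 mulmx1 mulmxV // scalar_mx_block block_mxKdr.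
  move=> x y Gx Gy; rewrite /rho2.
  have -> : rho1' (x *m y) = rho1' x *m rho1' y.
    by rewrite /rho1' rhoM // !mulmxA mulmxKV.
  have [a [C [D ->]]] := block x Gx; have [a' [C' [D' ->]]] := block y Gy.
  by rewrite mulmx_block !block_mxKdr mulmx0 add0r.
have [Q uQ HQ] := IHm rho2 rep2.
pose Q1 : 'M_(1 + m) := block_mx 1%:M 0 0 Q.
have uQ1 : Q1 \in unitmx by rewrite unitmxE det_ublock det1 mul1r -unitmxE.
exists (Q1 *m P0); first by rewrite unitmx_mul uQ1.
move=> g Gg; have [a [C [D E]]] := block g Gg.
have ED : rho2 g = D by rewrite /rho2 E block_mxKdr.
have -> : Q1 *m P0 *m rho g *m invmx (Q1 *m P0) =
    block_mx a%:M 0 (Q *m C) (Q *m D *m invmx Q).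
  have EP : P0 *m rho g = rho1' g *m P0 by rewrite /rho1' mulmxKV.
  have ET : Q1 *m rho1' g = block_mx a%:M 0 (Q *m C) (Q *m D *m invmx Q) *m Q1.
    rewrite E /Q1 !mulmx_block !mulmx0 !mul0mx !addr0 !add0r mulmx1 mul1mx.
    by rewrite mulmxKV // mulmx1.
  by rewrite -(mulmxA Q1) EP mulmxA ET -(mulmxA _ Q1 P0) mulmxK // unitmx_mul uQ1.
rewrite [is_trig_mx _](is_trig_block_mx a%:M 0 (Q *m C) (Q *m D *m invmx Q) erefl).
rewrite eqxx /= -{1}ED HQ // andbT.
by apply/is_trig_mxP => i j; rewrite !ord1.
Qed.

End LieKolchin.

(** * Triangular groups and Borel subgroups of GL_n *)

Section StableInverse.
Variables (F : fieldType) (n : nat) (S : 'M[F]_n -> Prop).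
Hypotheses (S0 : S 0) (SL : forall c M N, S M -> S N -> S (c *: M + N)).

(** A subspace stable under an injective linear map is mapped onto itself, by
   equality of dimensions. *)
Lemma stable_inverse (f f' : {linear 'M[F]_n -> 'M[F]_n}) : cancel f f' ->
  (forall M, S M -> S (f M)) -> forall M, S M -> S (f' M).
Proof.
move=> fK fS.
have [||W EW] := @subspace_mx F (n * n) (fun v => S (vec_mx v)).
- by rewrite linear0.
- by move=> c v w Sv Sw; rewrite linearP; apply: SL.
pose C := lin_mx f; pose C' := lin_mx f'.
have CK : C *m C' = 1%:M.
  apply/row_matrixP => i; rewrite row_mul !rowE mulmx1 !mul_rV_lin /= mxvecK.
  by rewrite fK vec_mxK.
have WC : (W *m C <= W)%MS.
  apply/row_subP => i; rewrite row_mul; apply/EW.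
  by rewrite mul_rV_lin mxvecK; apply/fS/EW; apply: row_sub.
have fC : row_free C by apply/row_freeP; exists C'.
have WWC : (W <= W *m C)%MS.
  have := mxrank_leqif_sup WC; rewrite /= mxrankMfree // => -[_ <-].
  by rewrite eqxx.
move=> M SM; have /submxP[u Eu] : (mxvec M <= W *m C)%MS.
  by apply: submx_trans WWC; apply/EW; rewrite mxvecK.
have -> : f' M = vec_mx (u *m W).
  rewrite -[M in LHS]mxvecK Eu -[u *m W]mulmx1 -CK !mulmxA.
  by rewrite [_ *m C']mul_rV_lin mxvecK.
by apply/EW; apply: submxMl.
Qed.

End StableInverse.

Lemma shift_unitmx (K : closedFieldType) n (M : 'M[K]_n) :
  exists c : K, M + c%:M \in unitmx.
Proof.
have [c nc] : exists c, ~~ root (char_poly M) c.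
  apply: NNPP => H; have := monic_neq0 (char_poly_monic M).
  move/eqP; apply; apply: poly_vanish_everywhere => t.
  by apply/eqP; apply: contraT => nt; case: H; exists t.
exists (- c); move: nc; rewrite -eigenvalue_root_char /eigenvalue /eigenspace.
by rewrite kermx_eq0 negbK row_free_unit rmorphN.
Qed.

Section Triangular.
Variables (K : closedFieldType) (n : nat).
Implicit Types (M N x y g : 'M[K]_n).

Definition lower i M : Prop := forall a b : 'I_n, (a < b + i)%N -> M a b = 0.

Lemma lower0 i : lower i 0.
Proof. by move=> a b _; rewrite mxE. Qed.

Lemma lowerL i c M N : lower i M -> lower i N -> lower i (c *: M + N).
Proof. by move=> HM HN a b lt; rewrite !mxE HM // HN // mulr0 addr0. Qed.

Lemma lowerD i M N : lower i M -> lower i N -> lower i (M + N).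
Proof. by move=> HM HN a b lt; rewrite !mxE HM // HN // addr0. Qed.

Lemma lowerN i M : lower i M -> lower i (- M).
Proof. by move=> HM a b lt; rewrite !mxE HM // oppr0. Qed.

Lemma lower1 : lower 0 1%:M.
Proof.
move=> a b; rewrite addn0 mxE => lt.
by case: eqP lt => // ->; rewrite ltnn.
Qed.

Lemma lower_weaken i j M : (i <= j)%N -> lower j M -> lower i M.
Proof.
move=> le HM a b lt; apply: HM; apply: leq_trans lt _.
by rewrite leq_add2l.
Qed.

Lemma lowerM i j M N : lower i M -> lower j N -> lower (i + j) (M *m N).
Proof.
move=> HM HN a b lt; rewrite mxE big1 // => c _.
have [ac|ca] := ltnP a (c + i); first by rewrite HM // mul0r.
rewrite HN ?mulr0 // -(ltn_add2r i); apply: leq_ltn_trans ca _.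
by rewrite -addnA (addnC j).
Qed.

(** For i > 0 both products already lie in level i + i; for i = 0 their
   diagonals coincide. *)
Lemma lower_commutator i M N : lower i M -> lower i N ->
  lower i.+1 (M *m N - N *m M).
Proof.
case: i => [|i] HM HN; last first.
  apply: (@lower_weaken _ (i.+1 + i.+1)); first by rewrite addSn ltnS leq_addl.
  by apply: lowerD; [|apply: lowerN]; apply: lowerM.
move=> a b; rewrite addn1 ltnS leq_eqVlt => /orP[/eqP/val_inj <-|lt]; last first.
  apply: (lowerD (lowerM HM HN) (lowerN (lowerM HN HM))).
  by rewrite !addn0.
rewrite !mxE -sumrB big1 // => c _.
have [lt|lt|/val_inj <-] := ltngtP a c.
- by rewrite HM ?addn0 // [N a c]HN ?addn0 // !mul0r subrr.
- by rewrite [N c a]HN ?addn0 // [M c a]HM ?addn0 // !mulr0 subrr.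
- by rewrite mulrC subrr.
Qed.

Lemma lower_inv M : M \in unitmx -> lower 0 M -> lower 0 (invmx M).
Proof.
move=> uM HM; rewrite -[invmx M]mulmx1.
apply: (@stable_inverse _ _ (lower 0) (@lower0 0) (@lowerL 0)
  (mulmx M) (mulmx (invmx M))); last exact: lower1.
  by move=> N /=; rewrite mulKmx.
by move=> N HN /=; apply: (@lowerM 0 0).
Qed.

Lemma lower_trig M : is_trig_mx M <-> lower 0 M.
Proof.
split=> [/is_trig_mxP HM a b|HM]; first by rewrite addn0; apply: HM.
by apply/is_trig_mxP => a b lt; apply: HM; rewrite addn0.
Qed.

Definition conj_by g M := g *m M *m invmx g.

Lemma conjM g M N : g \in unitmx -> conj_by g (M *m N) = conj_by g M *m conj_by g N.
Proof. by move=> ug; rewrite /conj_by !mulmxA mulmxKV. Qed.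

Lemma conjD g M N : conj_by g (M + N) = conj_by g M + conj_by g N.
Proof. by rewrite /conj_by mulmxDr mulmxDl. Qed.

Lemma conjN g M : conj_by g (- M) = - conj_by g M.
Proof. by rewrite /conj_by mulmxN mulNmx. Qed.

Lemma conjZ g c M : conj_by g (c *: M) = c *: conj_by g M.
Proof. by rewrite /conj_by -scalemxAr -scalemxAl. Qed.

Lemma conj1 g : g \in unitmx -> conj_by g 1%:M = 1%:M.
Proof. by move=> ug; rewrite /conj_by mulmx1 mulmxV. Qed.

Lemma conj_unit g M : g \in unitmx -> (conj_by g M \in unitmx) = (M \in unitmx).
Proof. by move=> ug; rewrite /conj_by !unitmx_mul unitmx_inv ug andbT. Qed.

Lemma conjV g M : g \in unitmx -> M \in unitmx ->
  conj_by g (invmx M) = invmx (conj_by g M).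
Proof.
move=> ug uM; have uC : conj_by g M \in unitmx by rewrite conj_unit.
by apply: (can_inj (mulKmx uC)); rewrite mulmxV // -conjM // mulmxV // conj1.
Qed.

Lemma conj_by_eq0 g M : g \in unitmx -> conj_by g M = 0 -> M = 0.
Proof.
move=> ug E; have -> : M = invmx g *m conj_by g M *m g.
  by rewrite /conj_by !mulmxA mulVmx // mul1mx mulmxKV.
by rewrite E mulmx0 mul0mx.
Qed.

(** Conjugates of the lower triangular group (i = 0) and of a descending
   filtration of its unipotent part (i > 0).  The condition is a linear one on
   x - 1, and the levels add up in products of such differences. *)
Definition trig_group g i : 'M[K]_n -> Prop :=
  fun x => GL K n x /\ lower i (conj_by g (x - 1%:M)).

Lemma trig_group0E g x : g \in unitmx ->
  trig_group g 0 x <-> GL K n x /\ lower 0 (conj_by g x).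
Proof.
move=> ug; rewrite /trig_group conjD conjN conj1 //.
split=> -[Gx Hx]; split=> //.
  by rewrite -[conj_by g x](subrK 1%:M); apply: lowerD Hx lower1.
by apply: lowerD => //; apply: lowerN; apply: lower1.
Qed.

Lemma trig_group_weaken g i j x : (i <= j)%N -> trig_group g j x -> trig_group g i x.
Proof. by move=> le [Gx Hx]; split=> //; apply: lower_weaken Hx. Qed.

Lemma trig_group_inv0 g i x : g \in unitmx -> trig_group g i x ->
  lower 0 (conj_by g (invmx x)).
Proof.
move=> ug Tx; rewrite conjV //; last by case: Tx.
case/(trig_group_weaken (leq0n i))/(trig_group0E _ ug): Tx => Gx Hx.
by apply: lower_inv => //; rewrite conj_unit.
Qed.

Lemma trig_group_subgroup g i : g \in unitmx -> is_subgroup (trig_group g i).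
Proof.
move=> ug; split.
- by move=> x [].
- by split; [apply: unitmx1 | rewrite conjD conjN subrr; apply: lower0].
- move=> x y [Gx Hx] [Gy Hy]; split.
    by rewrite /GL unitmx_mul; apply/andP.
  have -> : x *m y - 1%:M = (x - 1%:M) *m (y - 1%:M) + (x - 1%:M) + (y - 1%:M).
    rewrite mulmxBl mulmxBr mul1mx mulmx1; move: (x *m y) => z.
    by apply/matrixP => a b; rewrite !mxE; ring.
  rewrite (conjD g (_ + _)) (conjD g (_ *m _)) conjM //.
  apply: lowerD => //; apply: lowerD => //.
  by apply: (lower_weaken (leq_addl i i)); apply: lowerM.
- move=> x Tx; have [Gx Hx] := Tx; split; first by rewrite /GL unitmx_inv.
  have -> : invmx x - 1%:M = - (invmx x *m (x - 1%:M)).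
    by rewrite mulmxBr mulVmx // mulmx1 opprB.
  rewrite conjN conjM //; apply: lowerN.
  by rewrite -[i]add0n; apply: lowerM => //; apply: trig_group_inv0 ug Tx.
Qed.

(** [x, y] - 1 = x^-1 y^-1 ((x - 1) (y - 1) - (y - 1) (x - 1)). *)
Lemma trig_group_derived g i : g \in unitmx ->
  subset_of (derived_subgroup (trig_group g i)) (trig_group g i.+1).
Proof.
move=> ug; apply: derived_min; first exact: trig_group_subgroup.
move=> x y Tx Ty; have [Gx Hx] := Tx; have [Gy Hy] := Ty.
split.
  case: (trig_group_subgroup i ug) => GG _ _ _; apply: GG.
  by apply: subgroup_commutator => //; apply: trig_group_subgroup.
have -> : commutator x y - 1%:M = invmx x *m invmx y *m
    ((x - 1%:M) *m (y - 1%:M) - (y - 1%:M) *m (x - 1%:M)).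
  have -> : (x - 1%:M) *m (y - 1%:M) - (y - 1%:M) *m (x - 1%:M) =
      x *m y - y *m x.
    rewrite !mulmxBl !mulmxBr !mul1mx !mulmx1.
    by move: (x *m y) (y *m x) => z z'; apply/matrixP => a b; rewrite !mxE; ring.
  rewrite mulmxBr /commutator !mulmxA; congr (_ - _).
  by rewrite mulmxKV // mulVmx.
rewrite conjM // -[i.+1]add0n; apply: lowerM.
  by rewrite conjM //; apply: (@lowerM 0 0); apply: (@trig_group_inv0 _ i).
by rewrite (conjD g (_ *m _)) conjN !conjM //; apply: lower_commutator.
Qed.

Lemma trig_group_solvable g : g \in unitmx -> solvable_subgroup (trig_group g 0).
Proof.
move=> ug; exists n => x.
have main m : subset_of (iter m (@derived_subgroup K n) (trig_group g 0))
    (trig_group g m).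
  elim: m => [|m IHm] //= z /(derived_mono IHm); exact: trig_group_derived.
move/main => [_ Hx].
have /(conj_by_eq0 ug)/eqP : conj_by g (x - 1%:M) = 0.
  by apply/matrixP => a b; rewrite Hx ?mxE // ltn_addl.
by rewrite subr_eq0 => /eqP.
Qed.

Lemma trig_group_closed g i : Zariski_closed (trig_group g i).
Proof.
apply: (@closed_zeros _ _ (fun h => exists a b : 'I_n, (a < b + i)%N /\
   h = fun x => conj_by g (x - 1%:M) a b)).
  move=> h [a [b [_ ->]]].
  apply: regular_mx_mul; last exact: regular_mx_const.
  apply: regular_mx_mul; first exact: regular_mx_const.
  move=> c d; apply: (@regular_ext _ _ (fun x => x c d + - (1%:M : 'M[K]_n) c d)).
    by move=> x _; rewrite !mxE.
  by apply: regular_add; [apply: regular_entry|apply: regular_const].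
move=> x; split=> -[Gx Hx]; split=> //.
  by move=> _ [a [b [lt ->]]]; apply: Hx.
by move=> a b lt; apply: (Hx (fun x => conj_by g (x - 1%:M) a b)); exists a, b.
Qed.

Lemma trig_group_connected g i : g \in unitmx -> Zariski_connected (trig_group g i).
Proof.
move=> ug; have [GG G1 _ _] := trig_group_subgroup i ug.
apply: linear_connected => //; first by exists 1%:M.
move=> x y t [_ Hx] [_ Hy] Gz; split=> //.
have -> : x + t *: (y - x) - 1%:M = t *: (y - 1%:M) + (- t *: (x - 1%:M) + (x - 1%:M)).
  by apply/matrixP => a b; rewrite !mxE; ring.
move: (x - 1%:M) (y - 1%:M) Hx Hy => X Y Hx Hy.
by rewrite !(conjD, conjZ); apply: lowerL => //; apply: lowerL.
Qed.

Lemma trig_group_connected_solvable g : g \in unitmx ->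
  connected_solvable (GL K n) (trig_group g 0).
Proof.
move=> ug; split; [|exact: trig_group_connected|exact: trig_group_solvable].
split; [exact: trig_group_subgroup | exact: trig_group_closed | by move=> x []].
Qed.

Lemma connected_solvable_trig B : connected_solvable (GL K n) B ->
  exists2 g, g \in unitmx & subset_of B (trig_group g 0).
Proof.
move=> [[sB _ BG] cB solB].
have [|g ug Hg] := Lie_Kolchin (rho := id) sB cB solB.
  by split=> //; apply: regular_mx_id.
exists g => // x Bx; apply/trig_group0E => //; split; first exact: BG.
by apply/lower_trig/Hg.
Qed.

Lemma two_sided_cancel (q q' : 'M[K]_n) : q' *m q = 1%:M ->
  cancel (mulmxr q' \o mulmx q) (mulmxr q \o mulmx q').
Proof.
by move=> qK M /=; rewrite !mulmxA qK mul1mx -mulmxA qK mulmx1.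
Qed.

(** The triangular matrices are spanned by the invertible ones, so the inclusion
   extends to the corresponding conjugates of the algebra of triangular
   matrices, which have the same dimension. *)
Lemma trig_group_incl_eq g h : g \in unitmx -> h \in unitmx ->
  subset_of (trig_group g 0) (trig_group h 0) ->
  subset_of (trig_group h 0) (trig_group g 0).
Proof.
move=> ug uh gh x /(trig_group0E _ uh)[Gx Hx].
apply/trig_group0E => //; split=> //.
pose q := h *m invmx g; pose q' := g *m invmx h.
have qK : q' *m q = 1%:M by rewrite /q /q' mulmxA mulmxKV // mulmxV.
pose f := mulmxr q' \o mulmx q; pose f' := mulmxr q \o mulmx q'.
have -> : conj_by g x = f' (conj_by h x).
  by rewrite /f' /= /conj_by /q /q' !mulmxA mulmxKV // mulmxKV.
apply: (@stable_inverse _ _ (lower 0) (@lower0 0) (@lowerL 0) f f') => //.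
  exact: two_sided_cancel.
move=> M HM; have [c uM] := shift_unitmx M.
pose y := conj_by (invmx g) (M + c%:M).
have gy : conj_by g y = M + c%:M.
  by rewrite /y /conj_by invmxK !mulmxA mulmxV // mul1mx mulmxK.
have /gh/(trig_group0E _ uh)[_ Hy] : trig_group g 0 y.
  apply/trig_group0E => //; split.
    by rewrite /GL -[_ \in _](conj_unit _ ug) gy.
  by rewrite gy addrC -scalemx1; apply: lowerL => //; apply: lower1.
have f1 : f 1%:M = 1%:M.
  by rewrite /f /= mulmx1 /q /q' mulmxA mulmxKV // mulmxV.
have fM : f M = - c *: 1%:M + conj_by h y.
  have -> : conj_by h y = f (M + c%:M).
    by rewrite /y /f /= /conj_by /q /q' invmxK !mulmxA.
  have fL a X Y : f (a *: X + Y) = a *: f X + f Y by rewrite /f; apply: linearP.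
  by rewrite -(scalemx1 _ c) (addrC M) fL f1 scaleNr addKr.
change (lower 0 (f M)); rewrite fM.
by apply: lowerL => //; apply: lower1.
Qed.

(** By the Lie-Kolchin theorem, a connected solvable group containing this one
   lies in another conjugate of the triangular group, which is equal to it. *)
Lemma trig_group_Borel g : g \in unitmx -> is_Borel (GL K n) (trig_group g 0).
Proof.
move=> ug; split; first exact: trig_group_connected_solvable.
move=> B /connected_solvable_trig[h uh Bh] gB x /Bh.
by apply: trig_group_incl_eq => // y /gB/Bh.
Qed.

Lemma Borel_trig_group B : is_Borel (GL K n) B ->
  exists2 g, g \in unitmx & subset_of (trig_group g 0) B.
Proof.
move=> [/connected_solvable_trig[g ug Bg] maxB]; exists g => //.
by apply: maxB => //; apply: trig_group_connected_solvable.
Qed.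

Lemma trig_group_parabolic g : g \in unitmx ->
  is_parabolic (GL K n) (trig_group g 0).
Proof.
move=> ug; have [[cB _] _] := trig_group_Borel ug.
by case: (trig_group_Borel ug) => -[cl _ _] _; split=> //; exists (trig_group g 0);
   split=> //; apply: trig_group_Borel.
Qed.

End Triangular.

(** * Purely inseparable extensions and cyclic matrices *)

Lemma exprB_pchar (R : comNzRingType) p (x y : R) e : p \in [pchar R] ->
  (x - y) ^+ (p ^ e) = x ^+ (p ^ e) - y ^+ (p ^ e).
Proof.
move=> hp; have pn : [pchar R].-nat (p ^ e)%N.
  by rewrite pnatX pnatE ?hp // (pcharf_prime hp).
by rewrite exprDn_pchar // exprNn_pchar.
Qed.

Section PurelyInseparable.
Variables (k : fieldType) (p : nat).
Hypothesis hp : p \in [pchar k].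
Variable a : k.
Hypothesis ha : forall b, b ^+ p != a.

Let p_gt1 : (1 < p)%N.
Proof. by apply: prime_gt1; apply: pcharf_prime hp. Qed.

Lemma nonpower_neq0 : a != 0.
Proof.
by apply: contraTneq (ha 0) => ->; rewrite negbK expr0n gtn_eqF // ltnW.
Qed.

(** x ^ (p ^ e) - 1 = (x - 1) ^ (p ^ e). *)
Lemma pchar_expr1 (x : k) e : x ^+ (p ^ e) = 1 -> x = 1.
Proof.
move=> E; apply/eqP; rewrite -subr_eq0; apply/eqP.
have : (x - 1) ^+ (p ^ e) = 0.
  by rewrite (exprB_pchar _ _ _ hp) E expr1n subrr.
by move/eqP; rewrite expf_eq0 => /andP[_ /eqP].
Qed.

(** If a ^ m = 1, the factors p can be removed from m; then 1 is a
   combination of m and p, and a is a p-th power. *)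
Lemma nonpower_no_torsion m : (0 < m)%N -> a ^+ m != 1.
Proof.
move=> m0; apply/eqP => E.
have [e [m' [pm' Em]]] : exists e m', coprime p m' /\ m = (m' * p ^ e)%N.
  have pr := pcharf_prime hp.
  have [m' cop ->] := pfactor_coprime pr m0.
  by exists (logn p m), m'.
have m'0 : (0 < m')%N by move: m0; rewrite Em muln_gt0 => /andP[].
have {}E : a ^+ m' = 1 by apply: (@pchar_expr1 _ e); rewrite -exprM -Em.
case: (egcdnP p m'0) => km kn Ek _; move: Ek.
have -> : gcdn m' p = 1%N by apply/eqP; rewrite gcdnC.
move=> Ek; have E1 : (a ^+ kn) ^+ p * a = 1.
  by rewrite -exprM -exprSr -addn1 -Ek mulnC exprM E expr1n.
have := ha (a ^+ kn)^-1; rewrite exprVn; apply/negP; rewrite negbK.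
have X0 : (a ^+ kn) ^+ p != 0 by rewrite !expf_neq0 // nonpower_neq0.
by apply/eqP/(mulfI X0); rewrite mulfV.
Qed.

(** The powers of a witness that k is infinite. *)
Lemma nonpower_exp_inj : injective (fun i => a ^+ i).
Proof.
move=> i j /=; wlog le : i j / (i <= j)%N.
  by move=> H E; case: (leqP i j) => [/H|/ltnW/H e]; [apply|rewrite e].
move=> E; apply/eqP; rewrite eqn_leq le /= leqNgt; apply/negP => lt.
have := nonpower_no_torsion (m := j - i); rewrite subn_gt0 => /(_ lt)/negP; apply.
have ai0 : a ^+ i != 0 by rewrite expf_neq0 // nonpower_neq0.
by apply/eqP/(mulfI ai0); rewrite -exprD subnKC // mulr1.
Qed.

Variables (K : closedFieldType) (iota : {rmorphism k -> K}) (s : nat) (alpha : K).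
Hypothesis Ealpha : alpha ^+ (p ^ s) = iota a.

(** Otherwise alpha ^ g would lie in k for g the greatest common divisor of m
   and p ^ s, which is p ^ j with j < s, and a would be a p-th power. *)
Lemma root_power_irrational m b : (0 < m < p ^ s)%N -> alpha ^+ m != iota b.
Proof.
case/andP=> m0 ltm; apply/eqP => Em.
case: (egcdnP (p ^ s) m0) => km kn Ek _.
have /(dvdn_pfactor _ _ (pcharf_prime hp))[j _ Ej] := dvdn_gcdr m (p ^ s).
have ltj : (j < s)%N.
  rewrite -(ltn_exp2l _ _ p_gt1) -Ej; apply: leq_ltn_trans ltm.
  by apply: dvdn_leq => //; apply: dvdn_gcdl.
have an0 : iota a ^+ kn != 0 by rewrite expf_neq0 // fmorph_eq0 nonpower_neq0.
have Eg : alpha ^+ (p ^ j) = iota (b ^+ km / a ^+ kn).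
  rewrite rmorphM fmorphV !rmorphXn; apply: (canRL (mulfK an0)).
  by rewrite -Ej -Ealpha -Em -!exprM -exprD (mulnC m) Ek addnC (mulnC (p ^ s)%N).
have := ha ((b ^+ km / a ^+ kn) ^+ (p ^ (s - j.+1))); apply/negP; rewrite negbK.
rewrite -(inj_eq (fmorph_inj iota)) -Ealpha !rmorphXn -Eg -!exprM.
have -> : (p ^ s = p ^ j * (p ^ (s - j.+1) * p))%N.
  by rewrite -expnSr -expnD -subSn // subSS subnKC // ltnW.
by rewrite ?mulnA.
Qed.

Lemma pchar_iota : p \in [pchar K].
Proof. by rewrite (fmorph_pchar iota). Qed.

Lemma XsubC_expr_pchar :
  ('X - alpha%:P) ^+ (p ^ s) = 'X^(p ^ s) - (iota a)%:P.
Proof.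
by rewrite (@exprB_pchar _ p) ?pchar_poly ?pchar_iota // -Ealpha polyC_exp.
Qed.

(** A common factor over k of f and X^(p^s) - a is, over K, a power
   (X - alpha)^m with 0 < m < p^s up to a constant, and its constant
   coefficient would put alpha ^ m in k. *)
Lemma root_degree (f : {poly k}) : (size f <= p ^ s)%N ->
  root (map_poly iota f) alpha -> f = 0.
Proof.
move=> szf rf; apply: contraTeq isT => f0; exfalso.
pose q : {poly k} := 'X^(p ^ s) - a%:P.
have Eq : map_poly iota q = ('X - alpha%:P) ^+ (p ^ s).
  by rewrite XsubC_expr_pchar rmorphB /= map_polyXn map_polyC.
pose g := gcdp f q.
have g0 : g != 0 by rewrite gcdp_eq0 negb_and f0.
have : map_poly iota g %| ('X - alpha%:P) ^+ (p ^ s).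
  by rewrite -Eq dvdp_map dvdp_gcdr.
case/dvdp_exp_XsubCP => m _ eqg.
have szg : size g = m.+1.
  by rewrite -(size_map_poly iota) (eqp_size eqg) size_exp_XsubC.
have m0 : (0 < m)%N.
  have : root (map_poly iota g) alpha.
    rewrite gcdp_map root_gcd rf Eq rootE horner_exp !hornerE subrr expr0n.
    by rewrite expn_eq0 gtn_eqF // ltnW.
  rewrite (eqp_root eqg); case: m {eqg szg} => // .
  by rewrite expr0 rootC oner_eq0.
have ltm : (m < p ^ s)%N.
  by rewrite -szg; apply: leq_trans szf; apply: dvdp_leq => //; apply: dvdp_gcdl.
case/eqpP: eqg => -[c d] /= /andP[c0 d0] Ecd.
have lead : c * iota (lead_coef g) = d.
  have := congr1 lead_coef Ecd; rewrite !lead_coefZ lead_coef_map.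
  by rewrite (monicP (monic_exp _ (monicXsubC _))) mulr1.
have l0 : iota (lead_coef g) != 0 by rewrite fmorph_eq0 lead_coef_eq0.
have := congr1 (fun h => h.[0]) Ecd; rewrite /= !hornerZ horner_exp !hornerE.
rewrite -(rmorph0 iota) horner_map -lead -mulrA => /(mulfI c0).
rewrite exprNn => E.
have := @root_power_irrational m ((-1) ^+ m * g.[0] / lead_coef g).
rewrite m0 ltm => /(_ isT)/eqP; apply.
have s1 : (-1) ^+ m * (-1) ^+ m = 1 :> K by rewrite -exprMn mulrNN mulr1 expr1n.
rewrite !rmorphM fmorphV rmorphXn rmorphN1 E; apply: (mulIf l0).
by rewrite divfK //; move: ((-1) ^+ m) s1 => e s1; rewrite -[LHS]mul1r -s1; ring.
Qed.

End PurelyInseparable.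

Section Companion.
Variables (F : fieldType) (n : nat).

(** The matrix of multiplication by X on F[X] / (X^(n+1) - a) in the basis of
   the powers of X, acting on row vectors. *)
Definition cyclic_mx (a : F) : 'M[F]_n.+1 :=
  \matrix_(i, j) if j == i.+1 :> nat then 1
                 else if (i == n :> nat) && (j == 0 :> nat) then a else 0.

Variable a : F.
Let A := cyclic_mx a.
Let e i : 'rV[F]_n.+1 := delta_mx 0 i.

Lemma cyclic_mx_pow (i : 'I_n.+1) : e 0 *m A ^+ i = e i.
Proof.
case: i => i lti /=; elim: i lti => [|i IHi] lti.
  by rewrite expr0 mulmx1; congr (delta_mx _ _); apply/val_inj.
rewrite exprSr mulmxA (IHi (ltnW lti)) -rowE; apply/rowP => j.
rewrite !mxE -[j == Ordinal lti]val_eqE /=; case: eqP => // _.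
by rewrite [i == n]ltn_eqF.
Qed.

(** The first basis vector is cyclic, so it determines every matrix that
   commutes with the cyclic one. *)
Lemma cyclic_mx_ext (x y : 'M[F]_n.+1) : x *m A = A *m x -> y *m A = A *m y ->
  e 0 *m x = e 0 *m y -> x = y.
Proof.
move=> cx cy E; apply/row_matrixP => i; rewrite !rowE -[delta_mx 0 i]cyclic_mx_pow.
have cX z : z *m A = A *m z -> A ^+ i *m z = z *m A ^+ i.
  by move=> cz; apply/esym; apply: (@commrX _ z A i).
by rewrite -!mulmxA !cX // !mulmxA E.
Qed.

Lemma cyclic_mx_expr : A ^+ n.+1 = a%:M.
Proof.
apply: cyclic_mx_ext.
  by rewrite mulmxE -exprSr exprS.
  by rewrite mul_scalar_mx mul_mx_scalar.
rewrite exprSr mulmxA (cyclic_mx_pow ord_max) -rowE; apply/rowP => j.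
rewrite mul_mx_scalar !mxE eqxx /= eqxx /= ltn_eqF //.
by rewrite -val_eqE /=; case: eqP => _; rewrite ?mulr1 ?mulr0.
Qed.

Lemma cyclic_mx_commute (x : 'M[F]_n.+1) : x *m A = A *m x ->
  x = \sum_(i < n.+1) x 0 i *: A ^+ i.
Proof.
move=> cx; apply: cyclic_mx_ext => //.
  rewrite mulmx_suml mulmx_sumr; apply: eq_bigr => i _.
  by rewrite -scalemxAl -scalemxAr !mulmxE -exprSr exprS.
rewrite mulmx_sumr -rowE [LHS]row_sum_delta; apply: eq_bigr => i _.
by rewrite -scalemxAr cyclic_mx_pow mxE.
Qed.

End Companion.

Lemma map_cyclic_mx (k K : fieldType) (iota : {rmorphism k -> K}) n a :
  map_mx iota (cyclic_mx n a) = cyclic_mx n (iota a).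
Proof.
apply/matrixP => i j; rewrite !mxE.
by case: ifP => _; [|case: ifP => _]; rewrite ?rmorph1 ?rmorph0.
Qed.

(** * The adjoint action of a cyclic matrix *)

Section AdNilpotent.
Variables (R : pzRingType) (N : R).

Definition ad (Z : R) : R := N * Z - Z * N.

Lemma iter_adB t Z Z' : iter t ad (Z - Z') = iter t ad Z - iter t ad Z'.
Proof.
elim: t => //= t ->; rewrite /ad mulrBr mulrBl !opprB.
by rewrite addrACA [RHS]addrACA [- _ - _]addrC.
Qed.

(** Each application of ad N lowers by one either the power of N that kills Z on
   the left or the one that kills it on the right. *)
Lemma iter_ad_eq0 t i j Z : N ^+ i * Z = 0 -> Z * N ^+ j = 0 ->
  (i + j <= t.+1)%N -> iter t ad Z = 0.
Proof.
have iter0 r : iter r ad 0 = 0 by have := iter_adB r 0 0; rewrite !subrr.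
have trivial r i' j' Y : (i' == 0%N) || (j' == 0%N) ->
    N ^+ i' * Y = 0 -> Y * N ^+ j' = 0 -> iter r ad Y = 0.
  by case/orP=> /eqP ->; rewrite expr0 ?mul1r ?mulr1; [move=> -> _ | move=> _ ->];
     rewrite iter0.
elim: t i j Z => [|t IHt] [|i] [|j] Z; try by move=> E1 E2 _; apply: trivial E1 E2.
  by rewrite addSn addnS.
move=> E1 E2 le; rewrite iterSr iter_adB (IHt i j.+1) ?(IHt i.+1 j) ?subrr //.
- by rewrite mulrA E1 mul0r.
- by rewrite -mulrA -exprS.
- by move: le; rewrite addnS.
- by rewrite mulrA -exprSr.
- by rewrite -mulrA E2 mulr0.
Qed.

End AdNilpotent.

Section Companion.
Variables (k : fieldType) (K : closedFieldType) (iota : {rmorphism k -> K}).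
Variables (p : nat) (s n : nat) (a : k) (alpha : K).
Hypotheses (hp : p \in [pchar k]) (ha : forall b, b ^+ p != a).
Hypotheses (En : (p ^ s)%N = n.+1) (Ealpha : alpha ^+ (p ^ s) = iota a).

Let A := cyclic_mx n a.
Let AK := map_mx iota A.

(** In characteristic p, (X - b) ^ n = X ^ n - b ^ n for n = p ^ s. *)
Lemma cyclic_sub_scalar_expr b :
  (AK - b%:M) ^+ n.+1 = (iota a - b ^+ n.+1)%:M.
Proof.
have -> : AK - b%:M = horner_mx AK ('X - b%:P).
  by rewrite rmorphB /= horner_mx_X horner_mx_C.
rewrite -rmorphXn.
have -> : ('X - b%:P) ^+ n.+1 = 'X^(n.+1) - (b ^+ n.+1)%:P.
  by rewrite -En (@exprB_pchar _ p) ?pchar_poly ?(fmorph_pchar iota) // polyC_exp.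
rewrite !rmorphB /= horner_mx_C rmorphXn /= horner_mx_X.
by rewrite /AK map_cyclic_mx cyclic_mx_expr.
Qed.

(** y is f(A) for a nonzero polynomial f of degree less than p ^ s, which is
   prime to X ^ (p ^ s) - a; a Bezout relation gives the inverse. *)
Lemma commuting_unit (y : 'M[k]_n.+1) :
  y *m A = A *m y -> y != 0 -> y \in unitmx.
Proof.
move=> cy y0; have Ey := cyclic_mx_commute cy.
pose f : {poly k} := \poly_(i < n.+1) y 0 (inord i).
have fA : horner_mx A f = y.
  rewrite [RHS]Ey /f poly_def raddf_sum /=; apply: eq_bigr => i _.
  by rewrite linearZ /= rmorphXn /= horner_mx_X inord_val.
have f0 : f != 0 by apply: contraNneq y0 => f0; rewrite -fA f0 rmorph0.
pose q : {poly k} := 'X^(n.+1) - a%:P.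
have qA : horner_mx A q = 0.
  by rewrite rmorphB /= rmorphXn /= horner_mx_X horner_mx_C cyclic_mx_expr subrr.
have : coprimep f q.
  rewrite -(coprimep_map iota).
  have -> : map_poly iota q = ('X - alpha%:P) ^+ (p ^ s).
    by rewrite (XsubC_expr_pchar hp Ealpha) rmorphB /= map_polyXn map_polyC En.
  apply: coprimep_expr; rewrite coprimep_XsubC; apply: contra f0 => rf.
  apply/eqP; apply: (root_degree hp ha Ealpha) => //.
  by rewrite En; apply: size_poly.
case/Bezout_coprimepP => -[u v] /=; rewrite -size_poly_eq1 => /size_poly1P[c c0 E].
have := congr1 (horner_mx A) E.
rewrite rmorphD !rmorphM /= fA qA mulr0 addr0 horner_mx_C => Ec.
have : c%:M \in @unitmx k n.+1.
  by rewrite unitmxE det_scalar unitfE expf_neq0.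
by rewrite -Ec unitmx_mul => /andP[].
Qed.

(** ad A is nilpotent: over K it is the same map as ad (A - alpha), and
   A - alpha is nilpotent.  The last nonzero iterate of ad A at M is y. *)
Lemma ad_stable_commuting (S : 'M[k]_n.+1 -> Prop) M :
    (forall B, S B -> S (A *m B - B *m A)) -> S M -> M != 0 ->
  exists y, [/\ S y, y != 0 & y *m A = A *m y].
Proof.
move=> Sad SM M0.
pose N := AK - alpha%:M.
have adN : ad N =1 ad AK.
  move=> Z; rewrite /ad /N mulrBl mulrBr opprB -!mulmxE mul_scalar_mx mul_mx_scalar.
  by rewrite addrA subrK.
have N0 : N ^+ n.+1 = 0.
  by rewrite cyclic_sub_scalar_expr -Ealpha En subrr; apply/matrixP => i j; rewrite !mxE mul0rn.
have adK t B : map_mx iota (iter t (ad A) B) = iter t (ad AK) (map_mx iota B).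
  elim: t => //= t IHt; rewrite -IHt /ad -!mulmxE.
  by rewrite map_mxB !map_mxM.
have ex0 : exists t, iter t (ad A) M == 0.
  exists (n.+1 + n.+1)%N; rewrite -(map_mx_eq0 iota) adK; apply/eqP.
  rewrite -(eq_iter adN); apply: (@iter_ad_eq0 _ _ _ n.+1 n.+1) => //.
  - by rewrite N0 mul0r.
  - by rewrite N0 mulr0.
case: (ex_minnP ex0) => -[|t]; first by rewrite /= (negPf M0).
move=> Et mint; exists (iter t (ad A) M); split.
- by elim: t {Et mint} => //= t; apply: Sad.
- by apply: contraT; rewrite negbK => /mint; rewrite ltnn.
- by move: Et; rewrite /= subr_eq0 => /eqP.
Qed.

End Companion.

(** * Generators and normal unipotent subgroups of GL_n *)

Section Elementary.
Variables (F : fieldType) (n : nat).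
Implicit Types (u : 'cV[F]_n) (v w : 'rV[F]_n) (x N : 'M[F]_n).

Lemma row_col_sep v : v != 0 -> exists u, v *m u = 1%:M.
Proof.
case/rV0Pn => i vi; exists ((v 0 i)^-1 *: delta_mx i 0).
rewrite -scalemxAr -colE; apply/matrixP => a b; rewrite !ord1 !mxE.
by rewrite mulVf.
Qed.

Lemma row_col_dual v w : ~~ (w <= v)%MS -> v != 0 ->
  exists u, v *m u = 1%:M /\ w *m u = 0.
Proof.
rewrite submxE => wv v0; have [u0 vu0] := row_col_sep v0.
have [z [vz wz]] : exists z : 'cV[F]_n, v *m z = 0 /\ w *m z = 1%:M.
  have [y Ey] := row_col_sep wv.
  exists (cokermx v *m y); split; last by rewrite mulmxA.
  by rewrite mulmxA mulmx_coker mul0mx.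
exists (u0 - (w *m u0) 0 0 *: z); split.
  by rewrite mulmxBr -scalemxAr vz scaler0 subr0.
rewrite mulmxBr -scalemxAr wz scalemx1 [w *m u0]mx11_scalar.
by rewrite !mxE eqxx mulr1n subrr.
Qed.

Lemma col_pair_avoid (c d : 'cV[F]_n) : c != 0 -> d != 0 ->
  exists y : 'rV[F]_n, (y *m c) 0 0 != 0 /\ (y *m d) 0 0 != 0.
Proof.
move=> c0 d0.
have sep (e : 'cV[F]_n) : e != 0 -> exists y : 'rV[F]_n, (y *m e) 0 0 != 0.
  case/cV0Pn => i ei; exists (delta_mx 0 i); by rewrite -rowE mxE.
have [y yc] := sep c c0; have [z zd] := sep d d0.
have [yd|yd] := eqVneq ((y *m d) 0 0) 0; last by exists y.
have [zc|zc] := eqVneq ((z *m c) 0 0) 0; last by exists z.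
by exists (y + z); split; rewrite mulmxDl mxE ?yd ?zc ?add0r ?addr0.
Qed.

Lemma unit_elementary u v : 1 + (v *m u) 0 0 != 0 -> 1%:M + u *m v \in unitmx.
Proof.
set c := 1 + _ => c0; rewrite -row_free_unit; apply/row_freeP.
exists (1%:M - c^-1 *: (u *m v)).
have uvuv : u *m v *m (u *m v) = (c - 1) *: (u *m v).
  by rewrite -mulmxA (mulmxA v) [v *m u]mx11_scalar mul_scalar_mx -scalemxAr
     addrAC subrr add0r.
rewrite mulmxBr mulmx1 -scalemxAr mulmxDl mul1mx uvuv -[X in _ *: (X + _)]scale1r.
by rewrite -scalerDl (addrC 1 (c - 1)) subrK scalerA mulVf // scale1r addrK.
Qed.

(** By induction on the rank of x - 1.  Wedderburn's rank reduction subtracts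
   from N = x - 1 the rank-one matrix (N z) (y N) / (y N z), which is the effect
   on x of a multiplication by a rank-one perturbation of 1; y is chosen such
   that this perturbation is invertible. *)
Lemma elementary_generate (P : 'M[F]_n -> Prop) :
    (forall x y, P x -> P y -> P (x *m y)) -> (forall x, P x -> P (invmx x)) ->
    P 1%:M ->
    (forall u v, 1%:M + u *m v \in unitmx -> P (1%:M + u *m v)) ->
  forall x, x \in unitmx -> P x.
Proof.
move=> PM PV P1 Pel x; have [d] := ubnP (\rank (x - 1%:M)).
elim: d x => // d IHd x lt ux.
pose N := x - 1%:M; have Ex : x = 1%:M + N by rewrite addrC subrK.
have [N0|N0] := eqVneq N 0; first by rewrite Ex N0 addr0.
have [z Nz] : exists z : 'cV[F]_n, N *m z != 0.
  apply: NNPP => H; case/eqP: N0; apply/matrixP => i j.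
  have /eqP : N *m delta_mx j (0 : 'I_1) = 0.
    by apply/eqP; apply: contraT => nz; case: H; exists (delta_mx j 0).
  by rewrite -colE => /eqP/matrixP/(_ i 0); rewrite !mxE.
have xNz : invmx x *m (N *m z) != 0.
  by apply: contraNneq Nz => e; rewrite -[N *m z](mulKVmx ux) e mulmx0.
(* For the first factor the division by y N z, for the second one the
   invertibility of the perturbation. *)
have [y [yNz yxNz]] := col_pair_avoid Nz xNz.
pose b := (y *m (N *m z)) 0 0.
have Eb : y *m (N *m z) = b%:M by rewrite [LHS]mx11_scalar.
pose u := - (invmx x *m (N *m z)); pose v := b^-1 *: (y *m N).
have Exh : x *m (1%:M + u *m v) = x - (N *m z) *m v.
  by rewrite mulmxDr mulmx1 mulmxA mulmxN (mulKVmx ux) mulNmx.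
pose N' := x *m (1%:M + u *m v) - 1%:M.
have EN' : N' = N - (N *m z) *m v by rewrite /N' Exh addrAC.
have N'z : N' *m z = 0.
  rewrite EN' mulmxBl -(mulmxA _ v) /v -scalemxAl -(mulmxA y) Eb.
  by rewrite scale_scalar_mx mulVf // mulmx1 subrr.
have ltN' : (\rank N' < \rank N)%N.
  apply: rank_ltmx; rewrite ltmxE; apply/andP; split.
    rewrite EN' addmx_sub // -[v]/(_ *: _) -scalemxAr -scalerN.
    by rewrite scalemx_sub // mulmxA -mulNmx submxMl.
  apply/negP => /submxP[D ED]; case/eqP: Nz.
  by rewrite ED -mulmxA N'z mulmx0.
have uh : 1%:M + u *m v \in unitmx.
  apply: unit_elementary.
  have NxNz : N *m (invmx x *m (N *m z)) = N *m z - invmx x *m (N *m z).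
    by rewrite {1}/N mulmxBl (mulKVmx ux) mul1mx.
  rewrite /v /u mulmxN -scalemxAl -mulmxA NxNz mulmxBr Eb !mxE eqxx mulr1n.
  rewrite mulrBr mulVf // opprB addrC subrK.
  by apply: mulf_neq0; [rewrite invr_eq0 | move: yxNz; rewrite mxE].
have Px : P (x *m (1%:M + u *m v)).
  apply: IHd; first by apply: leq_trans ltN' _; rewrite -ltnS.
  by rewrite unitmx_mul ux.
have -> : x = x *m (1%:M + u *m v) *m invmx (1%:M + u *m v) by rewrite mulmxK.
by apply: PM => //; apply: PV; apply: Pel.
Qed.

End Elementary.

Lemma nilpotent_eigenvalue (F : fieldType) m (N : 'M[F]_m) e c :
  N ^+ e = 0 -> root (char_poly N) c -> c = 0.
Proof.
move=> Ne; rewrite -eigenvalue_root_char => /eigenvalueP[v Ev v0].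
have : v *m N ^+ e = c ^+ e *: v.
  elim: (e) => [|f IHf]; first by rewrite !expr0 mulmx1 scale1r.
  by rewrite exprSr mulmxA IHf -scalemxAl Ev scalerA exprSr.
move/esym/eqP; rewrite Ne mulmx0 scaler_eq0 (negPf v0) orbF expf_eq0.
by case/andP=> _ /eqP.
Qed.

Lemma nilpotent_trace (K : closedFieldType) m (N : 'M[K]_m) e : N ^+ e = 0 -> \tr N = 0.
Proof.
case: m N => [|m] N Ne; first by rewrite /mxtrace big_ord0.
apply: oppr_inj; rewrite -char_poly_trace // oppr0.
have [r Er] := closed_field_poly_normal (char_poly N).
rewrite (monicP (char_poly_monic N)) scale1r in Er.
have r0 c : c \in r -> c = 0.
  by move=> rc; apply: (nilpotent_eigenvalue Ne); rewrite Er root_prod_XsubC.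
have -> : char_poly N = 'X^(m.+1).
  have szr : size r = m.+1.
    by have := size_char_poly N; rewrite Er size_prod_XsubC => -[].
  rewrite Er -szr; elim: r r0 {Er szr} => [|c r IHr] r0; first by rewrite big_nil.
  rewrite big_cons (r0 c) ?mem_head // subr0 exprS IHr // => d dr.
  by apply: r0; rewrite inE dr orbT.
by rewrite coefXn /= ltn_eqF.
Qed.

Section NormalUnipotent.
Variables (K : closedFieldType) (n : nat).

(** Unipotent matrices have the trace of 1, so tr ((x - 1) (y - 1)) = 0 on V.
   Taking for y the conjugate of x by the transvection 1 + u phi, with
   phi u = 0, the trace becomes - (phi (x - 1) u)^2.  A matrix N such that
   phi N u = 0 whenever phi u = 0 is scalar, and x - 1 is nilpotent. *)
Lemma normal_unipotent_trivial (V : 'M[K]_n -> Prop) :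
    is_subgroup V -> normalised_by (GL K n) V -> unipotent_subgroup V ->
  forall x, V x -> x = 1%:M.
Proof.
move=> [VG _ VM _] nV uV x Vx.
have trV y : V y -> \tr y = \tr (1%:M : 'M[K]_n).
  move=> /uV[e /nilpotent_trace]; rewrite raddfB /= => /eqP.
  by rewrite subr_eq0 => /eqP.
have trVV y z : V y -> V z -> \tr ((y - 1%:M) *m (z - 1%:M)) = 0.
  move=> Vy Vz; have -> : (y - 1%:M) *m (z - 1%:M) =
      (y *m z - 1%:M) - (y - 1%:M) - (z - 1%:M).
    rewrite mulmxBl mulmxBr mul1mx mulmx1; move: (y *m z) => t.
    by apply/matrixP => i j; rewrite !mxE; ring.
  by rewrite !raddfB /= (trV _ (VM _ _ Vy Vz)) (trV y) // (trV z) //; ring.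
have [N EN] : exists N, x - 1%:M = N by exists (x - 1%:M).
have key (phi : 'rV[K]_n) (u : 'cV[K]_n) : phi *m u = 0 -> phi *m N *m u = 0.
  move=> pu.
  pose X := u *m phi; pose g := 1%:M + X; pose g' := 1%:M - X.
  have uu : X *m X = 0 by rewrite /X mulmxA -(mulmxA u) pu mulmx0 mul0mx.
  have gg' : g *m g' = 1%:M.
    by rewrite mulmxBr mulmx1 mulmxDl mul1mx uu addr0 addrK.
  have [ug _] := mulmx1_unit gg'.
  have g'E : g' = invmx g by rewrite -[g'](mulKmx ug) gg' mulmx1.
  have Vgx := nV g x ug Vx.
  have Eg : g *m x *m invmx g - 1%:M = g *m N *m g'.
    by rewrite -g'E -EN (mulmxBr g x) (mulmxBl (g *m x)) mulmx1 gg'.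
  have := trVV _ _ Vx Vgx; rewrite Eg EN.
  have NN : \tr (N *m N) = 0 by rewrite -EN; apply: trVV.
  have -> : \tr (N *m (g *m N *m g')) =
     \tr (N *m N) - \tr ((phi *m N *m u) *m (phi *m N *m u)).
    have -> : g *m N *m g' = N + X *m N - N *m X - X *m N *m X.
      by rewrite /g /g' mulmxDl mul1mx mulmxBr mulmx1 mulmxDl opprD addrA.
    rewrite !mulmxBr mulmxDr !raddfB raddfD /=.
    have -> : \tr (N *m (X *m N)) = \tr (N *m (N *m X)).
      by rewrite mulmxA mxtrace_mulC.
    rewrite addrK; congr (_ - _).
    have -> : N *m (X *m N *m X) = (N *m u) *m (phi *m N *m u *m phi).
      by rewrite /X !mulmxA.
    by rewrite mxtrace_mulC !mulmxA.
  rewrite NN sub0r [phi *m N *m u]mx11_scalar -scalar_mxM mxtrace_scalar mulr1n.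
  move/eqP; rewrite oppr_eq0 mulf_eq0 orbb => /eqP ->.
  by rewrite -scalemx1 scale0r.
(* The matrix units e_i, e_j, then e_i - e_j and e_i + e_j, show that N is scalar. *)
have offdiag i j : i != j -> N i j = 0.
  move=> ij; have z : delta_mx 0 i *m delta_mx j 0 = 0 :> 'M[K]_1.
    exact: mul_delta_mx_0.
  have := key _ _ z.
  by rewrite -rowE -colE => /matrixP/(_ 0 0); rewrite !mxE.
have diag i j : N i i = N j j.
  have [->//|ij] := eqVneq i j.
  have : (delta_mx 0 i - delta_mx 0 j) *m N *m (delta_mx i 0 + delta_mx j 0) = 0 :> 'M[K]_1.
    apply: key; rewrite mulmxBl !mulmxDr !mul_delta_mx.
    by rewrite !mul_delta_mx_0 // 1?eq_sym // addr0 add0r subrr.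
  rewrite mulmxBl -!rowE mulmxBl !mulmxDr -!colE => /matrixP/(_ 0 0).
  rewrite !mxE (offdiag i j) // (offdiag j i) 1?eq_sym // addr0 add0r.
  by move/eqP; rewrite subr_eq0 => /eqP.
have [e Ne] := uV x Vx; rewrite EN in Ne.
suff N0 : N = 0 by move/eqP: EN; rewrite N0 subr_eq0 => /eqP.
clear -offdiag diag Ne; case: n N offdiag diag Ne => [|m] N offdiag diag Ne.
  by apply/matrixP => -[].
have EN : N = (N 0 0)%:M.
  apply/matrixP => i j; rewrite [RHS]mxE; have [->|ij] := eqVneq i j.
    by rewrite mulr1n; apply: diag.
  by rewrite offdiag.
have : (N 0 0) ^+ e = 0.
  by move: Ne; rewrite EN -rmorphXn => /matrixP/(_ 0 0); rewrite !mxE eqxx mulr1n.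
by move/eqP; rewrite expf_eq0 => /andP[_ /eqP N00]; rewrite EN N00 -scalemx1 scale0r.
Qed.

End NormalUnipotent.

(** * Subgroups spanning the matrix algebra *)

Section SpanningParabolic.
Variables (K : closedFieldType) (n : nat).
Variables (P : 'M[K]_n.+1 -> Prop) (g : 'M[K]_n.+1).
Hypotheses (sP : is_subgroup P) (ug : g \in unitmx).
Hypothesis gP : subset_of (trig_group g 0) P.
Hypothesis Pspan : forall M, (forall x, P x -> \tr (M *m x) = 0) -> M = 0.

Let good (v : 'rV[K]_n.+1) : Prop :=
  forall u : 'cV[K]_n.+1, 1%:M + u *m v \in unitmx -> P (1%:M + u *m v).

Lemma good_mul v x : P x -> good v -> good (v *m x).
Proof.
have [PG _ PM PV] := sP.
move=> Px gv u; have ux : x \in unitmx by apply: PG.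
have E : 1%:M + u *m (v *m x) = invmx x *m (1%:M + x *m u *m v) *m x.
  by rewrite mulmxDr mulmx1 mulmxDl mulVmx // !mulmxA mulVmx // mul1mx.
rewrite E !unitmx_mul unitmx_inv ux andbT /= => uE.
by apply: (PM _ _ _ Px); apply: PM; [apply: PV | apply: gv].
Qed.

Lemma good_scale c v : good v -> good (c *: v).
Proof. by move=> gv u; rewrite -scalemxAr scalemxAl; apply: gv. Qed.

(** When v and w are independent, v + w is the image of v under an invertible
   matrix 1 + u w of P. *)
Lemma good_add v w : good v -> good w -> good (v + w).
Proof.
move=> gv gw; have [->|v0] := eqVneq v 0; first by rewrite add0r.
have [/sub_rVP[c ->]|wv] := boolP (w <= v)%MS.
  by rewrite -[v in X in good (X + _)]scale1r -scalerDl; apply: good_scale.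
have [u [vu wu]] := row_col_dual wv v0.
have -> : v + w = v *m (1%:M + u *m w) by rewrite mulmxDr mulmx1 mulmxA vu mul1mx.
apply: good_mul => //; apply: gw; apply: unit_elementary.
by rewrite wu mxE addr0 oner_eq0.
Qed.

Lemma good_Borel_line : good (delta_mx 0 0 *m g).
Proof.
move=> u Gx; apply: gP; split=> // a b; rewrite addn0 => lt.
rewrite [_ - _]addrC addKr /conj_by !mulmxA mulmxK // mxE big1 // => i _.
rewrite [delta_mx _ _ _ _]mxE -[b == 0]/(val b == 0%N) (gtn_eqF (leq_ltn_trans _ lt)) //.
by rewrite andbF mulr0.
Qed.

(** The rows v such that P contains every invertible 1 + u v form a P-stable
   subspace, nonzero because P contains a Borel subgroup.  A column c killed by
   all of them would give a matrix c v orthogonal to P. *)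
Lemma spanning_parabolic_full x : GL K n.+1 x -> P x.
Proof.
have [PG P1 PM PV] := sP.
have [||W EW] := @subspace_mx K n.+1 good.
- by rewrite -(scale0r (delta_mx 0 0 *m g)); apply/good_scale/good_Borel_line.
- by move=> c v w gv gw; apply: good_add => //; apply: good_scale.
pose v0 := delta_mx (0 : 'I_1) 0 *m g.
have v00 : v0 != 0.
  apply: contraTneq (oner_neq0 K) => e; rewrite negbK.
  have : v0 *m invmx g = 0 by rewrite e mul0mx.
  by rewrite mulmxK // => /matrixP/(_ 0 0); rewrite !mxE => /eqP.
have coker0 : cokermx W = 0.
  apply/matrixP => a b; pose c := col b (cokermx W).
  have cv0 : c *m v0 = 0.
    apply: Pspan => y Py; rewrite -mulmxA mxtrace_mulC.
    have /EW : good (v0 *m y) by apply: good_mul => //; apply: good_Borel_line.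
    rewrite submxE => /eqP H.
    have -> : v0 *m y *m c = col b (v0 *m y *m cokermx W) by rewrite /c !colE !mulmxA.
    by rewrite H /mxtrace big1 // => i _; rewrite !mxE.
  case/rV0Pn: v00 => j v0j; move/matrixP/(_ a j): cv0.
  rewrite mxE big_ord1 !mxE => /eqP; rewrite mulf_eq0 => /orP[/eqP //|].
  by move: v0j; rewrite mxE => /negPf ->.
apply: elementary_generate => // u v; suff : good v by apply.
by apply/EW; rewrite submxE coker0 mulmx0.
Qed.

End SpanningParabolic.

Section LinearForms.

Definition linear_form (R : nzRingType) n (v : 'rV[R]_(n * n)) : {mpoly R[n * n + 1]} :=
  \sum_l v 0 l *: 'X_(lshift 1 l).

Lemma linear_form_coef (R : nzRingType) n (v : 'rV[R]_(n * n)) l :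
  (linear_form v)@_(U_(lshift 1 l)) = v 0 l.
Proof.
rewrite /linear_form raddf_sum (bigD1 l) //= mcoeffZ mcoeffXU eqxx mulr1.
rewrite big1 ?addr0 // => i il; rewrite mcoeffZ mcoeffXU.
by rewrite (inj_eq (@lshift_inj _ _)) (negPf il) mulr0.
Qed.

Lemma linear_form_coef0 (R : nzRingType) n (v : 'rV[R]_(n * n)) m :
  (forall l, m <> U_(lshift 1 l)%MM) -> (linear_form v)@_m = 0.
Proof.
move=> H; rewrite /linear_form raddf_sum big1 // => i _ /=.
by rewrite mcoeffZ mcoeffX; case: eqP => [e|_]; rewrite ?mulr0 //; case: (H i).
Qed.

Lemma linear_form_eval (K : closedFieldType) n (M x : 'M[K]_n) :
  regular_eval (linear_form (mxvec M^T)) x = \tr (M *m x).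
Proof.
rewrite /regular_eval /linear_form raddf_sum /=.
rewrite mxtrace_mulC (reindex _ (curry_mxvec_bij _ _)) /=.
under [RHS]eq_bigr do rewrite mxE.
rewrite pair_bigA; apply: eq_bigr => -[a b] _ /=.
by rewrite mevalZ mevalXU GL_coords_entry mxvecE mxE mulrC.
Qed.

Variables (k : fieldType) (K : closedFieldType) (iota : {rmorphism k -> K}).

(** The linear form tr (M x) is a combination, with coefficients independent
   over k, of polynomials over k vanishing on X.  Independence forces the
   coefficients of the nonlinear monomials in each of these polynomials to
   vanish, so they are linear forms as well. *)
Lemma defined_over_linear_form n (X : 'M[K]_n -> Prop) (M : 'M[K]_n) :
    defined_over iota X -> M != 0 -> (forall x, X x -> \tr (M *m x) = 0) ->
  exists2 B : 'M[k]_n, B != 0 & forall x, X x -> \tr (map_mx iota B *m x) = 0.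
Proof.
move=> dX M0 XM.
pose f := linear_form (mxvec M^T).
have [|r [Xr Ef]] := dX f; first by move=> x Xx; rewrite linear_form_eval XM.
pose J q := vanishes_on X (map_mpoly iota q).
have JD q q' : J q -> J q' -> J (q + q').
  by move=> H H' x Xx; rewrite /regular_eval raddfD mevalD [X in X + _]H // [X in _ + X]H' // addr0.
have JZ c q : J q -> J (c *: q).
  by move=> H x Xx; rewrite /regular_eval map_mpolyZ mevalZ [X in _ * X]H // mulr0.
pose r' := [seq (q.1@_m, 'X_[m] * q.2) | q <- r, m <- msupp q.1].
have [|d [c [q [Jq Eq ind]]]] := independent_decomposition iota JD JZ (r := r').
  move=> _ /allpairsPdep[q0 [m [rq0 _ ->]]] /= x Xx.
  by rewrite /regular_eval rmorphM mevalM [X in _ * X](Xr q0 rq0 x Xx) mulr0.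
have {}Ef : f = \sum_i c i *: map_mpoly iota (q i).
  rewrite -Eq Ef big_allpairs_dep; apply: eq_bigr => q0 _ /=.
  rewrite {1}[q0.1]mpolyE mulr_suml; apply: eq_bigr => m _.
  by rewrite rmorphM /= map_mpolyX scalerAl.
have coefq m : f@_m = \sum_i iota ((q i)@_m) * c i.
  rewrite Ef raddf_sum; apply: eq_bigr => i _ /=.
  by rewrite mcoeffZ mcoeff_map_mpoly mulrC.
have qlin i : q i = linear_form (\row_l (q i)@_(U_(lshift 1 l))).
  apply/mpolyP => m.
  have [[l ->]|nl] := classic (exists l, m = U_(lshift 1 l)%MM).
    by rewrite linear_form_coef mxE.
  have nl' l : m <> U_(lshift 1 l)%MM by move=> e; case: nl; exists l.
  rewrite linear_form_coef0 //.
  by apply: (ind (fun i => (q i)@_m)); rewrite -coefq linear_form_coef0.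
have [i qi0] : exists i, q i != 0.
  apply: NNPP => H; case/eqP: M0; rewrite -[M]trmxK -[M^T]mxvecK.
  have -> : mxvec M^T = 0.
    apply/rowP => l; rewrite -linear_form_coef -/f coefq [RHS]mxE big1 // => i _.
    have -> : q i = 0 by apply/eqP; apply: contraT => nq; case: H; exists i.
    by rewrite mcoeff0 rmorph0 mul0r.
  by rewrite linear0 trmx0.
pose B := (vec_mx (\row_l (q i)@_(U_(lshift 1 l))))^T : 'M[k]_n.
have EB : mxvec B^T = \row_l (q i)@_(U_(lshift 1 l)) by rewrite trmxK vec_mxK.
exists B.
  apply: contraNneq qi0 => B0; rewrite qlin -EB B0 trmx0 linear0.
  by rewrite /linear_form big1 // => l _; rewrite mxE scale0r.
move=> x Xx; rewrite -linear_form_eval.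
have -> : linear_form (mxvec (map_mx iota B)^T) = map_mpoly iota (q i).
  rewrite [in RHS]qlin -EB /linear_form raddf_sum; apply: eq_bigr => l _ /=.
  by rewrite map_mpolyZ map_mpolyX map_trmx -map_mxvec mxE.
exact: Jq.
Qed.

End LinearForms.

(** * The centralizer of a cyclic matrix *)

Section TrivialGroup.
Variables (K : closedFieldType) (n : nat).

Definition trivial_group : 'M[K]_n -> Prop := fun x => x = 1%:M.

Lemma trivial_group_subgroup : is_subgroup trivial_group.
Proof.
split=> [x ->|//|x y -> ->|x ->]; rewrite /trivial_group ?mulmx1 ?invmx1 //.
exact: unitmx1.
Qed.

Lemma trivial_group_unipotent_radical (P : 'M[K]_n -> Prop) :
  is_subgroup P -> (forall x, GL K n x -> P x) ->
  is_unipotent_radical P trivial_group.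
Proof.
move=> sP GP; have [PG P1 PM PV] := sP.
split; last first.
  move=> V [[sV _ _] _ nV uV] x Vx; apply: (normal_unipotent_trivial sV _ uV Vx).
  by move=> g u Gg Vu; apply: nV => //; apply: GP.
split.
- split; last by move=> x ->.
    exact: trivial_group_subgroup.
  apply: (@closed_zeros _ _ (fun h => exists i j : 'I_n,
     h = fun x => x i j + - (1%:M : 'M[K]_n) i j)).
    move=> h [i [j ->]]; apply: regular_add; first exact: regular_entry.
    exact: regular_const.
  move=> x; split=> [->|[Gx Hx]].
    by split=> [|h [i [j ->]]]; [apply: unitmx1 | rewrite subrr].
  apply/matrixP => i j; apply/eqP; rewrite -subr_eq0; apply/eqP.
  by apply: (Hx (fun x => x i j + - (1%:M : 'M[K]_n) i j)); exists i, j.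
- apply: linear_connected => [x ->||x y t -> -> _]; first exact: unitmx1.
    by exists 1%:M.
  by rewrite /trivial_group subrr scaler0 addr0.
- by move=> g u Pg ->; rewrite /trivial_group mulmx1 mulmxV //; apply: PG.
- by move=> x ->; exists 1%N; rewrite expr1 subrr.
Qed.

Lemma full_group_Levi (P : 'M[K]_n -> Prop) :
  closed_subgroup (GL K n) P -> (forall x, GL K n x -> P x) -> is_Levi P P.
Proof.
move=> [sP cP PG] GP; split; first by split.
exists trivial_group; split; first exact: trivial_group_unipotent_radical.
have [_ P1 PM PV] := sP; split.
- by move=> g u Pg ->; rewrite /trivial_group mulmx1 mulmxV //; apply: PG.
- move=> x; split=> [Px|[l [u [Pl -> ->]]]]; last by rewrite mulmx1.
  by exists x, 1%:M; rewrite mulmx1.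
- by [].
- exists (fun i j => 'X_(entry_var i j)) => l u _ -> i j.
  by rewrite /regular_eval mevalXU GL_coords_entry mulmx1.
Qed.

Lemma defined_over_idfun (X : 'M[K]_n -> Prop) :
  defined_over (idfun : {rmorphism K -> K}) X.
Proof.
move=> f Xf; have Ef : map_mpoly (idfun : {rmorphism K -> K}) f = f.
  by apply/mpolyP => m; rewrite mcoeff_map_mpoly.
exists [:: (1, f)]; split=> [q|]; last by rewrite big_seq1 Ef mul1r.
by rewrite inE => /eqP ->; rewrite Ef.
Qed.

End TrivialGroup.

Lemma conjX (K : closedFieldType) n (g M : 'M[K]_n) e : g \in unitmx ->
  conj_by g (M ^+ e) = conj_by g M ^+ e.
Proof.
move=> ug; elim: e => [|e IHe]; first by rewrite !expr0 conj1.
by rewrite !exprS -!mulmxE conjM // IHe.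
Qed.

Lemma lowerX (K : closedFieldType) n (M : 'M[K]_n) e : lower 1 M -> lower e (M ^+ e).
Proof.
move=> HM; elim: e => [|e IHe]; first by rewrite expr0; apply: lower1.
by rewrite exprS -[e.+1]add1n; apply: lowerM.
Qed.

(** Every conjugate of a unipotent lower triangular matrix by the lower triangular
   group is again one; this places such matrices in the unipotent radical. *)
Lemma unitrig_connected_normal_unipotent (K : closedFieldType) n (g : 'M[K]_n) : g \in unitmx ->
  connected_normal_unipotent (trig_group g 0) (trig_group g 1).
Proof.
move=> ug; split.
- split; [exact: trig_group_subgroup | exact: trig_group_closed |].
  by move=> x; apply: trig_group_weaken.
- exact: trig_group_connected.
- move=> x u Tx Tu; have [Gx _] := Tx; have [Gu Hu] := Tu.
  have [_ _ TM TV] := trig_group_subgroup 0 ug.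
  split; first by rewrite /GL !unitmx_mul unitmx_inv; apply/andP; split=> //; apply/andP.
  have -> : x *m u *m invmx x - 1%:M = x *m (u - 1%:M) *m invmx x.
    by rewrite mulmxBr mulmxBl mulmx1 mulmxV.
  rewrite !conjM //; apply: (@lowerM _ _ 1 0); last exact: trig_group_inv0 ug Tx.
  by apply: (@lowerM _ _ 0 1) => //; case/(trig_group0E _ ug): Tx.
- move=> x [Gx Hx]; exists n; apply: (conj_by_eq0 ug).
  rewrite conjX //; apply/matrixP => a b; rewrite (lowerX (e := n) Hx) ?mxE //.
  by rewrite ltn_addl.
Qed.

Section Main.
Variables (k : fieldType) (K : closedFieldType) (iota : {rmorphism k -> K}).
Variables (p : nat) (s n : nat) (a : k) (alpha : K).
Hypotheses (hp : p \in [pchar k]) (ha : forall b, b ^+ p != a).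
Hypotheses (En : (p ^ s)%N = n.+1) (Ealpha : alpha ^+ (p ^ s) = iota a).

Let A := cyclic_mx n a.
Let AK := map_mx iota A.

Definition centralizer_GL (B : 'M[K]_n.+1) : 'M[K]_n.+1 -> Prop :=
  fun x => GL K n.+1 x /\ x *m B = B *m x.

Lemma centralizer_subgroup B : is_subgroup (centralizer_GL B).
Proof.
split.
- by move=> x [].
- by split; [apply: unitmx1 | rewrite mul1mx mulmx1].
- move=> x y [Gx cx] [Gy cy]; split.
    by rewrite /GL unitmx_mul; apply/andP.
  by rewrite -mulmxA cy mulmxA cx mulmxA.
- move=> x [Gx cx]; split; first by rewrite /GL unitmx_inv.
  by apply: (can_inj (mulmxK Gx)); apply: (can_inj (mulKmx Gx));
     rewrite mulmxKV // !mulmxA cx mulmxV // mul1mx.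
Qed.

Lemma centralizer_closed B : Zariski_closed (centralizer_GL B).
Proof.
apply: (@closed_zeros _ _ (fun h => exists i j : 'I_n.+1,
   h = fun x => (x *m B) i j + - (B *m x) i j)).
  move=> h [i [j ->]]; apply: regular_add; last apply: regular_opp.
    by apply: regular_mx_mul; [apply: regular_mx_id | apply: regular_mx_const].
  by apply: regular_mx_mul; [apply: regular_mx_const | apply: regular_mx_id].
move=> x; split=> -[Gx Hx]; split=> //.
  by move=> h [i [j ->]]; rewrite Hx subrr.
apply/matrixP => i j; apply/eqP; rewrite -subr_eq0; apply/eqP.
by apply: (Hx (fun x => (x *m B) i j + - (B *m x) i j)); exists i, j.
Qed.

Lemma centralizer_connected B : Zariski_connected (centralizer_GL B).
Proof.
have [GG C1 _ _] := centralizer_subgroup B.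
apply: linear_connected => //; first by exists 1%:M.
move=> x y t [_ cx] [_ cy] Gz; split=> //.
by rewrite mulmxDl mulmxDr -scalemxAl -scalemxAr mulmxBl mulmxBr cx cy.
Qed.

Lemma cyclic_map_expr : AK ^+ n.+1 = (iota a)%:M.
Proof. by rewrite /AK map_cyclic_mx cyclic_mx_expr. Qed.

Lemma centralizer_powers x : centralizer_GL AK x ->
  x = \sum_(i < n.+1) x 0 i *: AK ^+ i.
Proof. by case=> _; rewrite /AK map_cyclic_mx; apply: cyclic_mx_commute. Qed.

(** Every matrix commuting with A is a combination of powers of A, which have
   entries in k. *)
Lemma centralizer_defined_over : defined_over iota (centralizer_GL AK).
Proof.
pose E (M : 'M[k]_n.+1) := M *m A = A *m M.
have E0 : E 0 by rewrite /E mul0mx mulmx0.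
have EL c M M' : E M -> E M' -> E (c *: M + M').
  by rewrite /E => e e'; rewrite mulmxDl mulmxDr -scalemxAl -scalemxAr e e'.
apply: (defined_over_linear (nonpower_exp_inj hp ha) E0 EL) => x.
split=> -[Gx Hx]; split=> //; last first.
  elim: Hx => [|y c M _ IH EM]; first by rewrite mul0mx mulmx0.
  by rewrite mulmxDl mulmxDr -scalemxAl -scalemxAr IH -!map_mxM EM.
have -> : x = \sum_(i < n.+1) x 0 i *: map_mx iota (A ^+ i).
  rewrite [LHS]centralizer_powers //; apply: eq_bigr => i _.
  by rewrite rmorphXn.
elim: (index_enum _) => [|i r IHr]; first by rewrite big_nil; apply: extended_span0.
rewrite big_cons addrC; apply: extended_spanS => //.
by rewrite /E mulmxE -exprSr exprS.
Qed.

(** The orthogonal of P for the trace form is defined over k and stable under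
   ad A.  If it were nonzero, it would contain an invertible matrix over k
   commuting with A, whereas the orthogonal of a Borel subgroup consists of
   singular matrices. *)
Lemma trig_parabolic_spans (P : 'M[K]_n.+1 -> Prop) g :
    is_subgroup P -> g \in unitmx -> subset_of (trig_group g 0) P ->
    defined_over iota P -> subset_of (centralizer_GL AK) P ->
  forall M, (forall x, P x -> \tr (M *m x) = 0) -> M = 0.
Proof.
move=> [PG P1 PM PV] ug gP dP CP M PtrM; apply/eqP; apply: contraT => M0.
have [B B0 PtrB] := defined_over_linear_form dP M0 PtrM.
have uAK : AK \in unitmx.
  have : AK ^+ n.+1 \in unitmx.
    rewrite cyclic_map_expr unitmxE det_scalar unitfE expf_neq0 // fmorph_eq0.
    exact: (nonpower_neq0 hp ha).
  by rewrite exprS unitmx_mul => /andP[].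
have PAK : P AK by apply: CP; split.
pose S (C : 'M[k]_n.+1) := forall x, P x -> \tr (map_mx iota C *m x) = 0.
have [|y [Sy y0 cy]] := ad_stable_commuting (S := S) hp En Ealpha _ PtrB B0.
  move=> C SC x Px; rewrite map_mxB !map_mxM -/AK mulmxBl raddfB /=.
  rewrite -mulmxA mxtrace_mulC -mulmxA SC; last exact: PM.
  by rewrite -mulmxA SC ?subrr //; apply: PM.
have uy := commuting_unit hp ha En Ealpha cy y0.
pose Y := conj_by g (map_mx iota y).
have trY N : lower 0 N -> \tr (Y *m N) = 0.
  have trC N' : \tr (Y *m N') = \tr (map_mx iota y *m (invmx g *m N' *m g)).
    by rewrite /Y /conj_by -!mulmxA mxtrace_mulC !mulmxA.
  have trT N' : lower 0 N' -> N' \in unitmx -> \tr (Y *m N') = 0.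
    move=> HN uN; rewrite trC; apply/Sy/gP/trig_group0E => //.
    have Eg : conj_by g (invmx g *m N' *m g) = N'.
      by rewrite /conj_by !mulmxA mulmxV // mul1mx mulmxK.
    by split; [rewrite /GL -[_ \in _](conj_unit _ ug) Eg | rewrite Eg].
  (* Triangular matrices are combinations of the invertible ones N + c and 1. *)
  move=> HN; have [c uN] := shift_unitmx N.
  have HNc : lower 0 (N + c%:M).
    by rewrite addrC -scalemx1; apply: lowerL => //; apply: lower1.
  have := trT _ HNc uN; rewrite mulmxDr raddfD /= -scalemx1 -scalemxAr linearZ /=.
  by rewrite (trT 1%:M) ?unitmx1 //; [rewrite mulr0 addr0 | apply: lower1].
have Y0 (i j : 'I_n.+1) : (i <= j)%N -> Y i j = 0.
  move=> le; have : lower 0 (delta_mx j i : 'M[K]_n.+1).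
    move=> c d; rewrite addn0 !mxE => lt.
    by case: eqP => [ec|//]; case: eqP => // ed; move: lt; rewrite ec ed ltnNge le.
  move/trY; rewrite /mxtrace (bigD1 i) //= big1 ?addr0 => [|c ci].
    rewrite mxE (bigD1 j) //= big1 ?addr0 => [|d dj]; rewrite !mxE ?eqxx ?mulr1 //.
    by rewrite (negPf dj) mulr0.
  by rewrite mxE big1 // => d _; rewrite !mxE (negPf ci) andbF mulr0.
have : Y \in unitmx by rewrite conj_unit // map_unitmx.
rewrite unitmxE det_trig; last first.
  by apply/is_trig_mxP => i j /ltnW; apply: Y0.
by rewrite (bigD1 ord0) //= Y0 // mul0r unitr0.
Qed.

(** A parabolic subgroup P as in the hypothesis is the whole of GL_n, so it is a
   Levi subgroup of itself. *)
Lemma centralizer_cr_over : cr_over iota (GL K n.+1) (centralizer_GL AK).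
Proof.
move=> P [cP [B [BB BP]]] dP CP.
have [g ug gB] := Borel_trig_group BB.
have gP : subset_of (trig_group g 0) P by move=> x /gB/BP.
have [sP _ _] := cP.
exists P; split=> //; apply: full_group_Levi => //.
apply: (spanning_parabolic_full sP ug gP).
exact: (trig_parabolic_spans sP ug gP).
Qed.

(** The group lies in a Borel subgroup, and its unipotent element
   1 + (A - alpha) lies in the unipotent radical of that Borel subgroup, which
   meets a Levi subgroup trivially. *)
Lemma centralizer_not_cr : (0 < n)%N -> ~ cr (GL K n.+1) (centralizer_GL AK).
Proof.
move=> n0 crC.
have [g ug Cg] : exists2 g, g \in unitmx & subset_of (centralizer_GL AK) (trig_group g 0).
  apply: connected_solvable_trig; split; last 2 first.
  - exact: centralizer_connected.
  - exists 1%N; apply: (derived_min (G := @trivial_group K n.+1)).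
      exact: trivial_group_subgroup.
    move=> x y Cx Cy; have [Gx _] := Cx; have [Gy _] := Cy.
    have cxy : x *m y = y *m x.
      rewrite [x]centralizer_powers // [y]centralizer_powers //.
      rewrite mulmx_suml mulmx_sumr; apply: eq_bigr => i _.
      rewrite mulmx_suml mulmx_sumr; apply: eq_bigr => j _.
      rewrite -!(scalemxAl, scalemxAr) !scalerA mulrC.
      by rewrite !mulmxE -!exprD addnC.
    rewrite /commutator -!mulmxA cxy (mulKmx Gy) mulVmx //.
  split; [exact: centralizer_subgroup|exact: centralizer_closed|].
  by move=> x [].
have [|L [[_ [U [[_ maxU] [_ _ LU _]]]] _ CL]] :=
  crC _ (trig_group_parabolic ug) (@defined_over_idfun _ _ _) .
  exact: Cg.
pose N := AK - alpha%:M.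
have N0 : N ^+ n.+1 = 0.
  rewrite (cyclic_sub_scalar_expr iota a hp En) -Ealpha En subrr -scalemx1 scale0r //.
pose h := 1%:M + N.
have Ch : centralizer_GL AK h.
  split.
    have : h ^+ n.+1 \in unitmx.
      (* h ^ n = A ^ n - (alpha - 1) ^ n = 1 *)
      have -> : h = AK - (alpha - 1)%:M.
        by rewrite /h /N rmorphB /= opprB addrCA addrC.
      rewrite (cyclic_sub_scalar_expr iota a hp En) -En.
      rewrite (@exprB_pchar _ p) ?(fmorph_pchar iota) // Ealpha expr1n.
      by rewrite opprB addrCA subrr addr0 unitmx1.
    by rewrite exprS unitmx_mul => /andP[].
  rewrite /h /N mulmxDl mulmxDr mul1mx mulmx1 mulmxBl mulmxBr.
  by rewrite mul_scalar_mx mul_mx_scalar.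
have Uh : U h.
  apply: (maxU (trig_group g 1)); first exact: unitrig_connected_normal_unipotent.
  have [Gh Hh] := Cg _ Ch; split=> //.
  have hN : h - 1%:M = N by rewrite /h addrAC subrr add0r.
  rewrite hN in Hh *; move=> c d; rewrite addn1 ltnS leq_eqVlt.
  case/orP=> [/eqP/val_inj <-|lt]; last by apply: Hh; rewrite addn0.
  apply: (@nilpotent_eigenvalue _ _ (conj_by g N) n.+1).
    by rewrite -conjX // N0 /conj_by mulmx0 mul0mx.
  rewrite char_poly_trig; last exact/lower_trig.
  by rewrite /root horner_prod (bigD1 c) //= !hornerE subrr mul0r.
have := LU h (CL h Ch) Uh; rewrite /h => /eqP.
rewrite -subr_eq0 addrAC subrr add0r /N subr_eq0 => /eqP/matrixP.
move/(_ ord0 (Ordinal (n:=n.+1) (m := 1) n0)); rewrite /AK map_cyclic_mx !mxE /=.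
by move/eqP; rewrite mulr0n oner_eq0.
Qed.

End Main.

Theorem proposition1p8 (k : fieldType) (kbar : closedFieldType)
    (iota : {rmorphism k -> kbar}) (hbar : is_algebraic_closure iota)
    (p : nat) (hp : p \in [pchar k]) (hk : ~ perfect_field k)
    (s : nat) (hs : (1 <= s)%N) :
  exists H : 'M[kbar]_(p ^ s) -> Prop,
    [/\ k_subgroup iota (GL kbar (p ^ s)) H,
        cr_over iota (GL kbar (p ^ s)) H
      & ~ cr (GL kbar (p ^ s)) H].
Proof.
have [a ha] : exists a : k, forall b, b ^+ p != a.
  apply: NNPP => H; apply: hk => q hq a; apply: NNPP => Ha; apply: H.
  exists a => b; apply/eqP => Eb; apply: Ha; exists b.
  by rewrite (pcharf_eq hp) in hq; rewrite (eqP hq).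
have p_gt1 : (1 < p)%N by apply: prime_gt1; apply: pcharf_prime hp.
have ps_gt1 : (1 < p ^ s)%N by rewrite -(expn0 p) ltn_exp2l.
have [alpha Ealpha] : exists alpha, alpha ^+ (p ^ s) = iota a.
  have /closed_rootP[alpha] : size ('X^(p ^ s) - (iota a)%:P) != 1%N.
    by rewrite size_XnsubC ?eqSS -?lt0n // ltnW.
  rewrite rootE !hornerE subr_eq0 => /eqP; by exists alpha.
have [n En] : exists n, (p ^ s)%N = n.+1 by exists (p ^ s).-1; rewrite prednK // ltnW.
have n0 : (0 < n)%N by rewrite -ltnS -En.
suff main : exists H : 'M[kbar]_n.+1 -> Prop,
    [/\ k_subgroup iota (GL kbar n.+1) H, cr_over iota (GL kbar n.+1) H
      & ~ cr (GL kbar n.+1) H] by move: main; rewrite -En.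
exists (centralizer_GL (map_mx iota (cyclic_mx n a))); split.
- split; last exact: (centralizer_defined_over hp ha).
  split; [exact: centralizer_subgroup | exact: centralizer_closed | by move=> x []].
- exact: (centralizer_cr_over hp ha En Ealpha).
- exact: (centralizer_not_cr hp En Ealpha n0).
Qed.
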